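(* Let $p=p(n)\in[0,1]$ be a sequence of edge-probabilities satisfying $(\log n)^3 n^{-2/3}\le p\le 1$ for all sufficiently large $n$. Then the domination number $\gamma(G_{n,p})$ of the binomial random graph $G_{n,p}$ is concentrated on at most two values: there exists an integer $\hat r=\hat r(n,p)$ such that $$\mathbb{P}\bigl(\gamma(G_{n,p})\in\{\hat r,\hat r+1\}\bigr)\to 1\qquad\text{as } n\to\infty .$$
   Context: $G_{n,p}$ denotes the binomial random graph on vertex set $[n]=\{1,\dots,n\}$ in which each of the $\binom n2$ possible edges is included independently with probability $p$. A dominating set of a graph $G$ is a set $K\subseteq V(G)$ such that every vertex $v\in V(G)\setminus K$ has at least one neighbor in $K$. The domination number $\gamma(G)$ is the smallest number of vertices of a dominating set of $G$. The logarithm is the natural logarithm. *)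

(* Defs.v *)
From mathcomp Require Import all_boot all_order all_algebra.
From mathcomp Require Import all_classical all_reals all_analysis.
Set Implicit Arguments.
Unset Strict Implicit.
Unset Printing Implicit Defensive.
Import Order.TTheory GRing.Theory Num.Theory.
Import numFieldNormedType.Exports.

Local Open Scope set_scope.
Local Open Scope ring_scope.

(** A simple graph on the vertex set ['I_n] is given by its edge set
    [E : {set {set 'I_n}}], a subset of [vertex_pairs n]. *)
Definition vertex_pairs (n : nat) : {set {set 'I_n}} :=
  [set e : {set 'I_n} | #|e| == 2%N].

Definition dominating (n : nat) (E : {set {set 'I_n}}) (K : {set 'I_n}) : bool :=
  [forall v : 'I_n, (v \notin K) ==> [exists u in K, [set u; v] \in E]].

(** The full vertex set always dominates, so the minimum is over a nonempty
    family. *)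
Definition domination_number (n : nat) (E : {set {set 'I_n}}) : nat :=
  #|[arg min_(K < [set: 'I_n] | dominating E K) #|K|]|.

(** The probability that the edge set of the binomial random graph with [n]
    vertices and edge probability [p] is exactly [E]: the edges are independent
    Bernoulli([p]) variables. *)
Definition Gnp_mass (R : realType) (n : nat) (p : R) (E : {set {set 'I_n}}) : R :=
  \prod_(e in vertex_pairs n) (if e \in E then p else 1 - p).

Definition Gnp_prob (R : realType) (n : nat) (p : R)
    (A : pred {set {set 'I_n}}) : R :=
  \sum_(E in powerset (vertex_pairs n) | A E) Gnp_mass p E.

(* Main.v *)
(* Let [q = 1 - p], let [X_k] be the number of dominating [k]-sets, so that
   [E X_k = C(n,k) (1 - q^k)^(n-k)], and let [k] be least with
   [E X_k >= 1 / ln n].  The first moment of [X_(k-1)] shows that the domination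
   number is at least [k] with high probability.  As
   [E X_(k+1) / E X_k >= (n - k) / (k + 1)], the mean of [X_r], [r = k + 1], is at
   least [ln n], and it remains to show [E X_r^2 <= (1 + o(1)) (E X_r)^2].

   Let [K] and [L] be [r]-sets with [s] common vertices.  The vertices outside
   [K :|: L] contribute a factor [exp (O(n q^(2r-s) (1 - q^s)))] to the ratio of
   [P(K and L dominate)] to [P(K dominates)^2].  Inside [K :|: L] one needs that the
   bipartite graph between [K :\: L] and [L :\: K], helped by [K :&: L], has no
   isolated vertex.  Given that no vertex of [K :\: L] is isolated, the
   corresponding events for [L :\: K] are negatively dependent, so these vertices
   only contribute [exp (O(r^2 p q^(2r-1)))], which tends to 1 because
   [p^3 n^2 >= (ln n)^9].

   For fixed [K], the sum over [L] is split according to [s].  If [p >= 3/4] or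
   [p s <= 1], or if [p s > 1] and [p (r - s) > 6], the ratio is at most
   [c (1 + t)^s], which is summed by
   [sum_L (1 + t)^|K :&: L| <= C(n,r) exp (t r^2 / n)].  If [p (r - s) <= 6], then
   [P(L dominates | K dominates) <= n^(-2(r-s))], by the lower bound on [n q^r]
   coming from [E X_(k-1) < 1 / ln n]; the sum of [n^(-|L :\: K| - |K :\: L|)] over
   [L] is at most [e]. *)
Require Import Defs.
From mathcomp Require Import all_boot all_order all_algebra.
From mathcomp Require Import all_classical all_reals all_analysis.
From mathcomp Require Import fintype finset ring lra zify.
Set Implicit Arguments.
Unset Strict Implicit.
Unset Printing Implicit Defensive.
Import Order.TTheory GRing.Theory Num.Theory.
Import numFieldNormedType.Exports.
Local Open Scope ring_scope.

(** * Random subsets of a finite set *)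

Section RandomSubset.
Variables (R : realType) (T : finType) (p : R).
Hypotheses (p_ge0 : 0 <= p) (p_le1 : p <= 1).
Implicit Types (S C D W E : {set T}) (f g : {set T} -> R).

(** For [S = vertex_pairs n] this is [Gnp_mass]. A general ground set [S] lets elements be split off
    one at a time by induction. *)
Definition subset_mass S E : R := \prod_(e in S) (if e \in E then p else 1 - p).
Definition expect S f : R := \sum_(E in powerset S) subset_mass S E * f E.
Definition hit C E : R := (E :&: C != set0)%:R.
Definition avoid C E : R := (E :&: C == set0)%:R.

Lemma subset_mass_ge0 S E : 0 <= subset_mass S E.
Proof. by apply: prodr_ge0 => e _; case: ifP => _ //; rewrite subr_ge0. Qed.

Lemma eq_expect S f g : (forall E, f E = g E) -> expect S f = expect S g.
Proof. by move=> fg; apply: eq_bigr => E _; rewrite fg. Qed.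

Lemma expectD S f g : expect S (fun E => f E + g E) = expect S f + expect S g.
Proof. by rewrite -big_split; apply: eq_bigr => E _; rewrite mulrDr. Qed.

Lemma expectZ S c f : expect S (fun E => c * f E) = c * expect S f.
Proof. by rewrite mulr_sumr; apply: eq_bigr => E _; rewrite mulrCA. Qed.

Lemma expectB S f g : expect S (fun E => f E - g E) = expect S f - expect S g.
Proof.
rewrite -(mulN1r (expect S g)) -expectZ -expectD.
by apply: eq_expect => E; rewrite mulN1r.
Qed.

Lemma expect_sum S (I : finType) (P : pred I) (F : I -> {set T} -> R) :
  expect S (fun E => \sum_(i | P i) F i E) = \sum_(i | P i) expect S (F i).
Proof. by rewrite exchange_big; apply: eq_bigr => E _; rewrite mulr_sumr. Qed.

Lemma le_expect S f g : (forall E, f E <= g E) -> expect S f <= expect S g.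
Proof. by move=> fg; apply: ler_sum => E _; rewrite ler_wpM2l ?subset_mass_ge0. Qed.

Lemma expect_ge0 S f : (forall E, 0 <= f E) -> 0 <= expect S f.
Proof. by move=> f0; apply: sumr_ge0 => E _; rewrite mulr_ge0 ?subset_mass_ge0. Qed.

(** Condition on whether [e] belongs to the random set. *)
Lemma expect_split1 S e f : e \in S ->
  expect S f = p * expect (S :\ e) (fun E => f (e |: E))
               + (1 - p) * expect (S :\ e) f.
Proof.
move=> eS; rewrite /expect (bigID (fun E : {set T} => e \in E)) /=; congr (_ + _).
  rewrite mulr_sumr (reindex_onto (fun E => e |: E) (fun E => E :\ e)) /=; last first.
    by move=> E /andP[_ eE]; rewrite setD1K.
  apply: eq_big => [E|E /andP[/andP[ES _] /eqP eE]].
    rewrite !inE subUset sub1set eS/= eqxx /= andbT subsetD1.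
    congr (_ && _); apply/eqP/idP => [<-|eE]; first by rewrite !inE eqxx.
    by rewrite setU1K.
  rewrite mulrA; congr (_ * _); rewrite /subset_mass (bigD1 e) //= setU11; congr (_ * _).
  by apply: eq_big => [i|i /andP[_ /negPf ie]]; rewrite !inE 1?andbC ?ie.
rewrite mulr_sumr; apply: eq_big => [E|E /andP[ES /negPf eE]].
  by rewrite !inE subsetD1.
rewrite mulrA; congr (_ * _); rewrite /subset_mass (bigD1 e) //= eE; congr (_ * _).
by apply: eq_bigl => i; rewrite !inE andbC.
Qed.

Lemma expect1 S : expect S (fun=> 1) = 1.
Proof.
have [m] := ubnP #|S|; elim: m S => // m IH S Sm.
have [->|[e eS]] := set_0Vmem S.
  by rewrite /expect powerset0 big_set1 mulr1 /subset_mass big_set0.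
rewrite (expect_split1 _ eS) IH; first by ring.
by move: Sm; rewrite (cardsD1 e S) eS.
Qed.

(** The hypothesis on [f] says that [f] does not depend on [e]. Independence is expressed in this
    form throughout, later with a set [C] in place of [e]. *)
Lemma expect_avoid1 S e f : e \in S -> (forall E, f (E :\ e) = f E) ->
  expect S (fun E => (e \notin E)%:R * f E) = (1 - p) * expect S f.
Proof.
move=> eS fe; rewrite (expect_split1 _ eS) (expect_split1 f eS).
rewrite (_ : expect _ _ = 0); last first.
  by apply: big1 => E _; rewrite setU11 mul0r mulr0.
have -> : expect (S :\ e) (fun E => f (e |: E)) = expect (S :\ e) f.
  apply: eq_expect => E; rewrite -fe -[RHS]fe; congr f.
  by apply/setP => i; rewrite !inE; case: eqP.
have -> : expect (S :\ e) (fun E => (e \notin E)%:R * f E) = expect (S :\ e) f.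
  apply: eq_bigr => E; rewrite inE subsetD1 => /andP[_ ->].
  by rewrite mul1r.
by ring.
Qed.

Lemma expect_avoid S C f : C \subset S -> (forall E, f (E :\: C) = f E) ->
  expect S (fun E => avoid C E * f E) = (1 - p) ^+ #|C| * expect S f.
Proof.
have [m] := ubnP #|C|; elim: m C f => // m IH C f Cm CS fC.
have [C0|[e eC]] := set_0Vmem C.
  rewrite C0 cards0 expr0 mul1r; apply: eq_expect => E.
  by rewrite /avoid setI0 eqxx mul1r.
have fe E : f (E :\ e) = f E.
  rewrite -fC -[RHS]fC; congr f; apply/setP => i; rewrite !inE.
  by case: eqP => // ->; rewrite eC.
have eS : e \in S by exact: (subsetP CS _ eC).
have -> : expect S (fun E => avoid C E * f E)
        = expect S (fun E => (e \notin E)%:R * (avoid (C :\ e) E * f E)).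
  apply: eq_expect => E; rewrite mulrA; congr (_ * _).
  rewrite /avoid -natrM mulnb; congr ((nat_of_bool _)%:R).
  rewrite -{1}(setD1K eC) setIUr setU_eq0 -[X in _ && X]/(_ == _); congr (_ && _).
  by rewrite setI_eq0 disjoint_sym disjoints1.
rewrite expect_avoid1 //; last first.
  move=> E; rewrite fe; congr (_ * _); rewrite /avoid; congr ((nat_of_bool (_ == _))%:R).
  by apply/setP => i; rewrite !inE; case: eqP => //=; rewrite andbF.
rewrite IH.
- by rewrite (cardsD1 e C) eC exprS mulrA.
- by move: Cm; rewrite (cardsD1 e C) eC.
- exact: subset_trans (subD1set _ _) CS.
- move=> E; rewrite -fe -[RHS]fC; congr f; apply/setP => i; rewrite !inE.
  by case: eqP => [->|]/=; rewrite ?eC.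
Qed.

Lemma avoidE C E : avoid C E = 1 - hit C E.
Proof. by rewrite /avoid /hit; case: eqP => _ /=; rewrite ?subr0 ?subrr. Qed.

Lemma hit_ge0 C E : 0 <= hit C E. Proof. exact: ler0n. Qed.
Lemma hit_le1 C E : hit C E <= 1. Proof. by rewrite lern1 leq_b1. Qed.
Lemma avoid_ge0 C E : 0 <= avoid C E. Proof. exact: ler0n. Qed.

Lemma expect_hit S C f : C \subset S -> (forall E, f (E :\: C) = f E) ->
  expect S (fun E => hit C E * f E) = (1 - (1 - p) ^+ #|C|) * expect S f.
Proof.
move=> CS fC; rewrite mulrBl mul1r -(expect_avoid CS fC) -expectB.
by apply: eq_expect => E; rewrite avoidE; ring.
Qed.

Lemma hit_setD C D E : [disjoint C & D] -> hit C (E :\: D) = hit C E.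
Proof.
move=> CD; rewrite /hit; congr ((nat_of_bool (_ != _))%:R).
apply/setP => i; rewrite !inE.
by case: (boolP (i \in C)) => iC; rewrite ?andbF // (disjointFr CD iC).
Qed.

Lemma avoid_setD C D E : [disjoint C & D] -> avoid C (E :\: D) = avoid C E.
Proof. by move=> CD; rewrite !avoidE hit_setD. Qed.

Lemma hit_mono C D E : hit C (E :\: D) <= hit C E.
Proof.
rewrite /hit ler_nat; case: (E :&: C =P set0) => EC; last by case: eqP.
suff -> : (E :\: D) :&: C = set0 by rewrite eqxx.
by apply/eqP; rewrite -subset0 -EC setSI // subsetDl.
Qed.

(* Conditioning a row on being nonempty makes the rest of the row larger when
   one entry is known to be missing: this is what makes the events "column [v]
   is nonempty" negatively dependent given that all rows are nonempty. *)
Lemma expect_hit_avoid1 S W e f :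
  W \subset S -> e \in W ->
  (forall E, 0 <= f E) ->
  (forall E, f (E :\ e) = f E) -> (forall E, f (E :\: W) <= f E) ->
  (1 - p) * (1 - (1 - p) ^+ #|W|.-1) * expect S (fun E => hit W E * f E)
  <= (1 - (1 - p) ^+ #|W|) * expect S (fun E => (e \notin E)%:R * (hit W E * f E)).
Proof.
move=> WS eW f0 fe fW; set q := 1 - p.
set W' := W :\ e; have cW : #|W| = #|W'|.+1 by rewrite (cardsD1 e W) eW.
have eS : e \in S by exact: (subsetP WS _ eW).
have W'S : W' \subset S by exact: subset_trans (subD1set _ _) WS.
have W'e E : (E :\ e) :&: W' = E :&: W'.
  by apply/setP => i; rewrite !inE; case: eqP => //=; rewrite andbF.
have hitW E : hit W E = ((e \in E) || (E :&: W' != set0))%:R.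
  rewrite /hit; congr ((nat_of_bool _)%:R).
  rewrite -{1}(setD1K eW) setIUr setU_eq0 negb_and; congr (_ || _).
  by rewrite setI_eq0 disjoint_sym disjoints1 negbK.
set F := expect S (fun E => hit W' E * f E).
set f0E := expect S (fun E => f (E :\: W)).
have hW'e E : hit W' (E :\ e) = hit W' E by rewrite /hit W'e.
have -> : expect S (fun E => (e \notin E)%:R * (hit W E * f E)) = q * F.
  rewrite -(expect_avoid1 (e := e)) //; last by move=> E; rewrite fe hW'e.
  by apply: eq_expect => E; rewrite hitW /hit; case: (e \in E); rewrite ?mul0r.
have fWW' E : f (E :\: W :\: W') = f (E :\: W).
  by congr f; apply/setP => i; rewrite !inE; case: (i \in W); case: eqP.
(* Where [E] misses [W'], [f E] equals [f (E :\: W)] because [f] ignores [e], and the latter value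
   is independent of [W']. *)
have avW : expect S (fun E => avoid W' E * f E) = q ^+ #|W'| * f0E.
  rewrite /q -expect_avoid //; last first.
    by move=> E; congr f; apply/setP => i; rewrite !inE; case: (i \in W); case: eqP.
  apply: eq_expect => E; rewrite /avoid; case: eqP => E0; rewrite ?mul0r // !mul1r.
  rewrite -fe; congr f; apply/setP => i; rewrite !inE.
  move/setP: E0 => /(_ i); rewrite !inE.
  by case: (i =P e) => [->|_] /=; rewrite ?eW //; case: (i \in W) => //=; rewrite andbT => ->.
(* The row [W] is hit either inside [W'], or only at [e], which happens with probability [p] when
   [W'] is missed. *)
have -> : expect S (fun E => hit W E * f E) = F + p * (q ^+ #|W'| * f0E).
  rewrite -avW.
  have -> : p * expect S (fun E => avoid W' E * f E)
     = expect S (fun E => avoid W' E * f E) - q * expect S (fun E => avoid W' E * f E).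
    by rewrite /q; ring.
  rewrite /q -(expect_avoid1 (e := e)) //; last by move=> E; rewrite fe /avoid W'e.
  rewrite -expectB -expectD; apply: eq_expect => E.
  rewrite hitW avoidE /hit; case: (e \in E); case: (_ != _) => /=; ring.
have Fge : (1 - q ^+ #|W'|) * f0E <= F.
  rewrite /q -expect_hit //; last first.
    by move=> E; congr f; apply/setP => i; rewrite !inE; case: (i \in W); case: eqP.
  by apply: le_expect => E; rewrite ler_wpM2l ?hit_ge0.
(* The right side minus the left side is [q * p * y * (F - (1 - y) * f0E)], which is nonnegative by
   [Fge]. *)
rewrite cW /= exprS; set y := q ^+ #|W'| in Fge *.
have [p0 p1] := (p_ge0, p_le1).
have q01 : 0 <= q <= 1 by rewrite /q; lra.
have y01 : 0 <= y <= 1 by apply/andP; split; [apply: exprn_ge0|apply: exprn_ile1]; lra.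
have pq : p = 1 - q by rewrite /q; ring.
have := ler_wpM2l (_ : 0 <= q * p * y) Fge.
have qpy : 0 <= q * p * y by rewrite !mulr_ge0 //; lra.
move=> /(_ qpy); rewrite pq => H; rewrite -subr_ge0 in H; rewrite -subr_ge0.
apply: le_trans H _; rewrite le_eqVlt; apply/orP; left; apply/eqP; ring.
Qed.

End RandomSubset.

(** * Products of independent events *)

Section RandomSubsetProducts.
Variables (R : realType) (T : finType) (p : R).
Hypotheses (p_ge0 : 0 <= p) (p_le1 : p <= 1).
Implicit Types (S C D W E : {set T}) (f g : {set T} -> R).

(** Product rule: [C i] is the set of elements on which [F i] depends. Since the other factors and
    [f] ignore [C i], each factor comes out as the constant [c]. *)
Lemma expect_prod S (I : finType) (V : {set I}) (F : I -> {set T} -> R)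
    (C : I -> {set T}) (c : R) f :
  (forall i h, i \in V -> (forall E, h (E :\: C i) = h E) ->
     expect p S (fun E => F i E * h E) = c * expect p S h) ->
  (forall i j E, i \in V -> j \in V -> i != j -> F i (E :\: C j) = F i E) ->
  (forall i E, i \in V -> f (E :\: C i) = f E) ->
  expect p S (fun E => (\prod_(i in V) F i E) * f E) = c ^+ #|V| * expect p S f.
Proof.
have [m] := ubnP #|V|; elim: m V => // m IH V Vm Fc FC fC.
have [->|[i iV]] := set_0Vmem V.
  by rewrite cards0 mul1r; apply: eq_expect => E; rewrite big_set0 mul1r.
have Vi : {subset V :\ i <= V} by move=> j /setD1P[].
rewrite (cardsD1 i V) iV exprS -mulrA -IH; last first.
- by move=> j E /Vi; apply: fC.
- by move=> j k E /Vi jV /Vi; apply: FC.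
- by move=> j h /Vi; apply: Fc.
- by move: Vm; rewrite (cardsD1 i V) iV.
rewrite -(Fc i) //; last first.
  move=> E; rewrite fC //; congr (_ * _); apply: eq_bigr => j /setD1P[ji jV].
  exact: FC.
by apply: eq_expect => E; rewrite (big_setD1 i iV) /= mulrA.
Qed.

(** Inclusion-exclusion over the events that [C] or [D] is missed. *)
Lemma expect_hit2 S C D f : C \subset S -> D \subset S ->
  (forall E, f (E :\: (C :|: D)) = f E) ->
  expect p S (fun E => hit R C E * hit R D E * f E) =
  (1 - (1 - p) ^+ #|C| - (1 - p) ^+ #|D| + (1 - p) ^+ #|C :|: D|) * expect p S f.
Proof.
move=> CS DS fCD.
have fC E : f (E :\: C) = f E.
  by rewrite -fCD -[RHS]fCD; congr f; apply/setP => i; rewrite !inE; case: (i \in C).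
have fD E : f (E :\: D) = f E.
  by rewrite -fCD -[RHS]fCD; congr f; apply/setP => i; rewrite !inE; case: (i \in C);
     case: (i \in D).
have CDS : C :|: D \subset S by rewrite subUset CS.
rewrite mulrDl !mulrBl mul1r -!expect_avoid // -!expectB -expectD.
apply: eq_expect => E; rewrite /avoid /hit setIUr setU_eq0.
by case: (_ :&: C == _); case: (_ :&: D == _) => /=; ring.
Qed.

Lemma avoid_setU C D E : avoid R (C :|: D) E = avoid R C E * avoid R D E.
Proof. by rewrite /avoid -natrM mulnb setIUr setU_eq0. Qed.

Lemma avoid_set1 (e : T) E : avoid R [set e] E = (e \notin E)%:R.
Proof. by rewrite /avoid setI_eq0 disjoint_sym disjoints1. Qed.

End RandomSubsetProducts.

(** * Stars and dominating sets *)

Section Star.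
Variable n : nat.
Implicit Types (u v : 'I_n) (K L : {set 'I_n}).

(** The possible edges from [v] to [K]: a vertex [v] outside [K] is dominated exactly when the edge
    set hits [star v K]. *)
Definition star v K : {set {set 'I_n}} := [set [set u; v] | u in K].

Lemma star_sub v K : v \notin K -> star v K \subset vertex_pairs n.
Proof.
move=> vK; apply/subsetP => _ /imsetP[u uK ->]; rewrite inE cards2.
by case: (u =P v) uK vK => // -> ->.
Qed.

Lemma card_star v K : v \notin K -> #|star v K| = #|K|.
Proof.
move=> vK; apply: card_in_imset => u w uK wK /setP /(_ u).
rewrite !inE eqxx /= => /esym /orP[/eqP //|/eqP uv].
by move: vK; rewrite -uv uK.
Qed.

(** The only edge that two such stars can share is the one joining [v] and [v']. *)
Lemma star_disjoint v v' K K' : v != v' -> ~~ ((v \in K') && (v' \in K)) ->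
  [disjoint star v K & star v' K'].
Proof.
move=> vv H; rewrite -setI_eq0; apply/eqP/setP => e; rewrite !inE.
apply/negP => /andP[/imsetP[u uK eu] /imsetP[u' uK' eu']].
have /setP eq : [set u; v] = [set u'; v'] by rewrite -eu.
have := eq v; rewrite !inE eqxx orbT => /esym /orP[/eqP vu|]; last by rewrite (negPf vv).
have := eq v'; rewrite !inE eqxx orbT => /orP[/eqP vu'|]; last by rewrite eq_sym (negPf vv).
by move: H; rewrite vu uK' vu' uK.
Qed.

Lemma starU v K L : star v (K :|: L) = star v K :|: star v L.
Proof. exact: imsetU. Qed.

Lemma mem_star u v K : v \notin K -> u != v -> ([set u; v] \in star v K) = (u \in K).
Proof.
move=> vK uv; apply/imsetP/idP => [[w wK /setP/(_ u)]|uK]; last by exists u.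
by rewrite !inE eqxx /= => /esym/orP[/eqP->//|]; rewrite (negPf uv).
Qed.

End Star.

(** * Probability that two given sets both dominate *)

Section PairBound.
Variables (R : realType) (n : nat) (p : R).
Hypotheses (p_ge0 : 0 <= p) (p_le1 : p <= 1).
Implicit Types (u v : 'I_n) (K L U V : {set 'I_n}) (E : {set {set 'I_n}}).
Local Notation q := (1 - p).
Local Notation Ex := (expect p (vertex_pairs n)).

Lemma dominatingE E K :
  (dominating E K)%:R = \prod_(v in ~: K) hit R (star v K) E.
Proof.
have hitE v : hit R (star v K) E = [exists u in K, [set u; v] \in E]%:R.
  rewrite /hit; congr ((nat_of_bool _)%:R); apply/set0Pn/exists_inP.
    by move=> [e /setIP[eE /imsetP[u uK eu]]]; exists u => //; rewrite -eu.
  move=> [u uK uE]; exists [set u; v]; rewrite inE uE; exact: imset_f.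
have [/forallP D|] := boolP (dominating E K).
  rewrite big1 // => v; rewrite inE => vK; rewrite hitE.
  by have /implyP -> := D v.
rewrite negb_forall => /existsP[v]; rewrite negb_imply => /andP[vK nv].
by rewrite (bigD1 v) /= ?inE // hitE (negPf nv) mul0r.
Qed.

(** The stars of distinct vertices outside [K] are disjoint, so the vertices are dominated
    independently. *)
Lemma expect_dominating K :
  Ex (fun E => (dominating E K)%:R) = (1 - q ^+ #|K|) ^+ (n - #|K|).
Proof.
have := @expect_prod R _ p (vertex_pairs n) _ (~: K)
  (fun v => hit R (star v K)) (fun v => star v K) (1 - q ^+ #|K|) (fun=> 1).
rewrite expect1 mulr1 [#|~: _|]cardsCs setCK card_ord => <- //.
- by apply: eq_expect => E; rewrite mulr1 dominatingE.
- move=> v h; rewrite inE => vK hK.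
  by rewrite expect_hit ?card_star ?star_sub.
- move=> v w E; rewrite !inE => vK wK vw; rewrite hit_setD // star_disjoint //.
  by rewrite (negPf vK).
Qed.

Section Pair.
Variables (K L : {set 'I_n}) (r : nat).
Hypotheses (cK : #|K| = r) (cL : #|L| = r).
Local Notation A := (K :\: L).
Local Notation B := (L :\: K).
Local Notation s := #|K :&: L|.
Local Notation a := (r - s)%N.

(** View the edges between [A] and [B] as a 0-1 matrix. [rows] asks that each vertex of [A] has a
    neighbour in [L], [cols V] that each vertex of [V], a part of [B], has one in [K]; the two
    depend on common edges. *)
Definition rows E : R := \prod_(u in A) hit R (star u L) E.
Definition cols V E : R := \prod_(v in V) hit R (star v K) E.

Lemma card_KDL : #|A| = a. Proof. by rewrite cardsD cK. Qed.
Lemma card_LDK : #|B| = a. Proof. by rewrite cardsD cL setIC. Qed.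
Lemma card_KUL : #|K :|: L| = (r + a)%N.
Proof. by rewrite cardsU cK cL addnBA // -cK subset_leq_card ?subsetIl. Qed.

Lemma expect_rows : Ex rows = (1 - q ^+ r) ^+ a.
Proof.
have := @expect_prod R _ p (vertex_pairs n) _ A
  (fun v => hit R (star v L)) (fun v => star v L) (1 - q ^+ r) (fun=> 1).
rewrite expect1 mulr1 card_KDL => <- //.
- by apply: eq_expect => E; rewrite mulr1.
- move=> v h; rewrite inE => /andP[vL _] hL.
  by rewrite expect_hit ?card_star ?star_sub // cL.
- move=> v w E; rewrite !inE => /andP[vL _] _ vw; rewrite hit_setD // star_disjoint //.
  by rewrite (negPf vL).
Qed.

(** Vertices outside [K :|: L] use disjoint stars and factor out by [expect_hit2]. What remains is
    the domination of [A] by [L] and of [B] by [K]. *)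
Lemma expect_pair :
  Ex (fun E => (dominating E K)%:R * (dominating E L)%:R)
  = (1 - 2 * q ^+ r + q ^+ (r + a)) ^+ (n - (r + a)) * Ex (fun E => rows E * cols B E).
Proof.
have := @expect_prod R _ p (vertex_pairs n) _ (~: (K :|: L))
  (fun v E => hit R (star v K) E * hit R (star v L) E)
  (fun v => star v (K :|: L)) (1 - 2 * q ^+ r + q ^+ (r + a)) (fun E => rows E * cols B E).
rewrite [#|~: _|]cardsCs setCK card_ord card_KUL => <- //.
- apply: eq_expect => E; rewrite !dominatingE.
  have splitC (X Y : {set 'I_n}) (F : 'I_n -> R) :
    \prod_(v in ~: X) F v = \prod_(v in ~: (X :|: Y)) F v * \prod_(v in Y :\: X) F v.
    rewrite (bigID (mem (~: Y))) /=; congr (_ * _); apply: eq_bigl => v;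
      by rewrite !inE; case: (v \in X); case: (v \in Y).
  rewrite (splitC K L) (splitC L K) [L :|: K]setUC /rows /cols big_split /=; ring.
- move=> v h; rewrite !inE negb_or => /andP[vK vL]; rewrite starU => hK.
  rewrite expect_hit2 ?star_sub // -starU !card_star ?cK ?cL //; last first.
    by rewrite inE negb_or vK.
  by rewrite card_KUL; congr (_ * _); ring.
- move=> v w E; rewrite !inE !negb_or => /andP[vK vL] /andP[wK wL] vw.
  by rewrite !hit_setD // star_disjoint // ?inE (negPf vK) ?(negPf vL).
- move=> v E; rewrite !inE !negb_or => /andP[vK vL].
  rewrite /rows /cols; congr (_ * _); apply: eq_bigr => w; rewrite inE => /andP[w1 w2];
    rewrite hit_setD // star_disjoint //.
  + by apply: contraNneq vK => <-.
  + by rewrite (negPf vL) andbF.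
  + by apply: contraNneq vL => <-.
  + by rewrite (negPf vK) andbF.
Qed.

Variable z : R.
Hypotheses (x_lt1 : q ^+ r < 1) (z_ge0 : 0 <= z)
  (zE : z * (1 - q ^+ r) = q * (1 - q ^+ r.-1)).

Lemma rows_ge0 E : 0 <= rows E. Proof. by apply: prodr_ge0 => *; apply: hit_ge0. Qed.
Lemma cols_ge0 V E : 0 <= cols V E. Proof. by apply: prodr_ge0 => *; apply: hit_ge0. Qed.

(** The number [z] is the conditional probability that a given entry of a nonempty row is missing.
    The entries of column [v] are removed one by one with [expect_hit_avoid1]: the other nonempty
    columns only make missing entries of column [v] more likely. *)
Lemma expect_column_avoided V v U : v \in B -> V \subset B :\ v -> U \subset A ->
  z ^+ #|U| * Ex (fun E => rows E * cols V E)
  <= Ex (fun E => avoid R (star v U) E * (rows E * cols V E)).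
Proof.
move=> vB VB.
have /setDP[vL vK] := vB.
have [m] := ubnP #|U|; elim: m U => // m IH U Um UA.
have [->|[u uU]] := set_0Vmem U.
  rewrite cards0 mul1r le_eqVlt; apply/orP; left; apply/eqP; apply: eq_expect => E.
  by rewrite /avoid /star imset0 setI0 eqxx mul1r.
have uA : u \in A by apply: (subsetP UA).
have /setDP[uK uL] := uA.
have uv : u != v by apply: contraNneq vK => <-.
have cU : #|U| = #|U :\ u|.+1 by rewrite (cardsD1 u U) uU.
have {}IH : z ^+ #|U :\ u| * Ex (fun E => rows E * cols V E)
  <= Ex (fun E => avoid R (star v (U :\ u)) E * (rows E * cols V E)).
  apply: IH; first by move: Um; rewrite cU.
  exact: subset_trans (subD1set _ _) UA.
(* The integrand without row [u]. It ignores the edge [[set u; v]], and among its factors only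
   [cols V] depends on [star u L], in an increasing way. *)
pose f E := \prod_(w in A :\ u) hit R (star w L) E * (cols V E * avoid R (star v (U :\ u)) E).
have f_ge0 E : 0 <= f E.
  by rewrite mulr_ge0 ?mulr_ge0 ?cols_ge0 ?avoid_ge0 ?prodr_ge0 // => *; apply: hit_ge0.
have eL : [set u; v] \in star u L by rewrite setUC mem_star // eq_sym.
have edge1 (w : 'I_n) (X : {set 'I_n}) :
    [set u; v] \notin star w X -> [disjoint star w X & [set [set u; v]]].
  by move=> H; rewrite disjoint_sym disjoints1.
have starNe (w : 'I_n) (X : {set 'I_n}) : w != u -> w != v -> [set u; v] \notin star w X.
  move=> wu wv; apply/imsetP => -[y _ /setP/(_ w)]; rewrite !inE eqxx orbT.
  by rewrite (negPf wu) (negPf wv).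
have VBv w : w \in V -> [/\ w \in L, w \notin K & w != v].
  by move=> wV; have := subsetP VB _ wV; rewrite !inE => /and3P[].
have fe E : f (E :\ [set u; v]) = f E.
  rewrite /f /cols; congr (_ * (_ * _)).
  - apply: eq_bigr => w; rewrite !inE => /and3P[wu wL wK].
    rewrite hit_setD // edge1 // starNe //.
    by apply: contraNneq vK => <-.
  - apply: eq_bigr => w /VBv[wL wK wv]; rewrite hit_setD // edge1 // starNe //.
    by apply: contraNneq uL => <-.
  - rewrite avoid_setD // disjoint_sym disjoints1 mem_star //; first by rewrite !inE eqxx.
    by rewrite !inE negb_and; apply/orP; right; apply: contra vK => /(subsetP UA) /setDP[].
have fW E : f (E :\: star u L) <= f E.
  rewrite /f [X in X * _ <= _](_ : _ = \prod_(w in A :\ u) hit R (star w L) E);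
    last first.
    apply: eq_bigr => w; rewrite !inE => /and3P[wu wL wK].
    by rewrite hit_setD // star_disjoint // (negPf wL).
  apply: ler_wpM2l; first by apply: prodr_ge0 => *; apply: hit_ge0.
  rewrite [X in _ * X <= _](_ : _ = avoid R (star v (U :\ u)) E); last first.
    by rewrite avoid_setD // star_disjoint 1?eq_sym // !inE eqxx andbF.
  rewrite ler_wpM2r ?avoid_ge0 // ler_prod // => w _.
  by rewrite hit_ge0 hit_mono.
have WS : star u L \subset vertex_pairs n by apply: star_sub.
have := expect_hit_avoid1 p_ge0 p_le1 WS eL f_ge0 fe fW.
rewrite card_star // cL -zE.
have -> : Ex (fun E => hit R (star u L) E * f E)
        = Ex (fun E => avoid R (star v (U :\ u)) E * (rows E * cols V E)).
  apply: eq_expect => E; rewrite /f /rows (big_setD1 u uA) /=; ring.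
have -> : Ex (fun E => ([set u; v] \notin E)%:R * (hit R (star u L) E * f E))
        = Ex (fun E => avoid R (star v U) E * (rows E * cols V E)).
  apply: eq_expect => E; rewrite /f /rows (big_setD1 u uA) /=.
  rewrite -{2}(setD1K uU) starU avoid_setU [star v [set u]]imset_set1 avoid_set1; ring.
set X := Ex _ in IH *; set Y := Ex _ in IH *; set Z := Ex _.
move=> H; rewrite cU exprS -mulrA.
apply: le_trans (ler_wpM2l z_ge0 IH) _.
have x1 : 0 < 1 - q ^+ r by rewrite subr_gt0.
by rewrite -(ler_pM2l x1) mulrA [_ * z]mulrC.
Qed.

(** Columns are added one at a time. Column [v] is empty when the [s] edges to [K :&: L] are
    missing, which is independent of the rest, and the [a] edges to [A] are missing, which has
    conditional probability at least [z ^+ a]. *)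
Lemma expect_rows_cols V : q ^+ s * z ^+ a <= 1 -> V \subset B ->
  Ex (fun E => rows E * cols V E)
  <= (1 - q ^+ r) ^+ a * (1 - q ^+ s * z ^+ a) ^+ #|V|.
Proof.
move=> y1; have [m] := ubnP #|V|; elim: m V => // m IH V Vm VB.
have [->|[v vV]] := set_0Vmem V.
  rewrite cards0 mulr1 -expect_rows le_eqVlt; apply/orP; left; apply/eqP.
  by apply: eq_expect => E; rewrite /cols big_set0 mulr1.
have cV : #|V| = #|V :\ v|.+1 by rewrite (cardsD1 v V) vV.
have vB : v \in B by apply: (subsetP VB).
have /setDP[vL vK] := vB.
have IH' : Ex (fun E => rows E * cols (V :\ v) E)
  <= (1 - q ^+ r) ^+ a * (1 - q ^+ s * z ^+ a) ^+ #|V :\ v|.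
  apply: IH; first by move: Vm; rewrite cV.
  exact: subset_trans (subD1set _ _) VB.
have -> : Ex (fun E => rows E * cols V E) = Ex (fun E => rows E * cols (V :\ v) E)
  - Ex (fun E => avoid R (star v (K :&: L)) E *
      (avoid R (star v A) E * (rows E * cols (V :\ v) E))).
  rewrite -expectB; apply: eq_expect => E; rewrite {1}/cols (big_setD1 v vV) /=.
  rewrite [avoid _ _ _ * (avoid _ _ _ * _)]mulrA -avoid_setU -starU.
  rewrite setID.
  by rewrite avoidE /cols; ring.
rewrite expect_avoid; last first.
- move=> E; rewrite /rows /cols; congr (_ * (_ * _)).
  + rewrite avoid_setD // -setI_eq0; apply/eqP/setP => e; rewrite !inE.
    apply/negP => /andP[/imsetP[u uA ->]]; move: uA; rewrite inE => /andP[uL uK].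
    rewrite mem_star ?inE ?(negPf uL) ?andbF ?(negPf vK) //.
    by apply: contraNneq vK => <-.
  + apply: eq_bigr => w; rewrite inE => /andP[wL wK].
    rewrite hit_setD // star_disjoint //; first by apply: contraNneq vK => <-.
    by rewrite inE (negPf wL) andbF.
  + apply: eq_bigr => w; rewrite inE => /andP[]; rewrite inE => wv wV.
    have /setDP[wL wK] := subsetP VB _ wV.
    by rewrite hit_setD // star_disjoint // inE (negPf wK).
- by apply: star_sub; rewrite inE negb_and vK.
rewrite card_star; last by rewrite inE negb_and vK.
have VBv : V :\ v \subset B :\ v by apply: setSD.
have H := expect_column_avoided vB VBv (subxx A).
rewrite card_KDL in H.
rewrite cV exprSr mulrA.
apply: le_trans (ler_wpM2r _ IH'); last by rewrite subr_ge0.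
rewrite mulrBr mulr1 lerD2l lerN2 mulrC -mulrA ler_wpM2l ?exprn_ge0 ?subr_ge0 //.
Qed.

End Pair.
End PairBound.

(** * Counting and the second moment *)

Lemma bernoulli_ineq (R : realType) (y : R) (m : nat) :
  0 <= y <= 1 -> 1 - m%:R * y <= (1 - y) ^+ m.
Proof.
move=> /andP[y0 y1]; elim: m => [|m IH]; first by rewrite mul0r subr0.
have h : 0 <= 1 - y by lra.
have := ler_wpM2l h IH; rewrite -exprS; apply: le_trans.
have m0 : 0 <= m%:R :> R by [].
rewrite -natr1; nra.
Qed.

Section Counting.
Variable R : realType.

Lemma sum_pow_subsets (T : finType) (X : {set T}) (t : R) :
  \sum_(J : {set T} | J \subset X) t ^+ #|J| = (1 + t) ^+ #|X|.
Proof.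
have := @bigA_distr R 0 1 *%R +%R T (fun i => if i \in X then t else 0) (fun=> 1).
rewrite (bigID (mem X)) /= [X in _ * X]big1 ?mulr1; last first.
  by move=> i /negPf ->; rewrite add0r.
rewrite (eq_bigr (fun=> 1 + t)); last by move=> i ->; rewrite addrC.
rewrite prodr_const => ->; rewrite [RHS](bigID (fun J : {set T} => J \subset X)) /=.
rewrite [X in _ + X]big1 ?addr0; last first.
  move=> J /subsetPn[i iJ /negPf iX].
  by rewrite (bigD1 i) //= iJ iX mul0r.
apply: eq_big => // J JX; rewrite (bigID (mem J)) /= [X in _ * X]big1 ?mulr1; last first.
  by move=> i /negPf ->.
rewrite (eq_bigr (fun=> t)) ?prodr_const // => i iJ.
by rewrite iJ (subsetP JX).
Qed.

(** Such an [L] corresponds to [L :\: J], a subset of the complement of [J] with [r - #|J|]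
    elements. *)
Lemma card_supersets (T : finType) (J : {set T}) (r : nat) : (#|J| <= r)%N ->
  #|[set L : {set T} | J \subset L & #|L| == r]| = 'C(#|T| - #|J|, r - #|J|).
Proof.
move=> Jr; rewrite -[#|T|]cardsT -cardsDS ?subsetT // setTD -cards_draws.
rewrite -[RHS](card_in_imset (f := fun L => L :|: J)); last first.
  move=> L L'; rewrite !inE => /andP[LJ _] /andP[LJ' _] /setP H.
  apply/setP => i; have := H i; rewrite !inE.
  have [iJ|] := boolP (i \in J); last by rewrite !orbF.
  have out (X : {set T}) : X \subset ~: J -> i \in X = false.
    by move=> XJ; apply/negP => /(subsetP XJ); rewrite inE iJ.
  by rewrite !out.
congr #|pred_of_set _|; apply/setP => L; rewrite !inE; apply/idP/imsetP.
  move=> /andP[JL /eqP cL]; exists (L :\: J); last first.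
    by rewrite setUC -[LHS](setID L J) (setIidPr JL).
  by rewrite !inE subsetDr cardsDS // cL eqxx.
move=> [M]; rewrite inE => /andP[MJ /eqP cM ->]; rewrite subsetUr /= cardsU cM.
have -> : M :&: J = set0.
  by apply/eqP; rewrite setI_eq0 -[J]setCK disjoints_subset setCK.
by rewrite cards0 subn0 subnK.
Qed.

(** The quotient of the two binomials is a product of factors [(r - i) / (n - i)], each at most
    [r / n]. *)
Lemma bin_sub_le (n r t : nat) : (t <= r)%N -> (r <= n)%N ->
  ('C(n - t, r - t) * n ^ t <= 'C(n, r) * r ^ t)%N.
Proof.
move=> + rn; elim: t => [|t IH] tr; first by rewrite !subn0.
have {}IH := IH (ltnW tr).
have tn : (t < n)%N by apply: leq_trans rn.
have := mul_bin_diag (n - t) (r - t).-1.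
rewrite prednK ?subn_gt0 // -!subnS => E.
have le1 : ((r - t) * n <= r * (n - t))%N.
  rewrite mulnBl mulnBr [(r * n)%N]mulnC leq_sub2l // mulnC leq_mul2l rn orbT //.
have nt : (0 < n - t)%N by rewrite subn_gt0.
rewrite -(leq_pmul2l nt) expnS (expnS r).
apply: leq_trans (_ : ((r - t) * n * ('C(n - t, r - t) * n ^ t) <= _)%N).
  by rewrite mulnA E; apply: eq_leq; ring.
apply: leq_trans (leq_mul le1 IH) _.
by apply: eq_leq; ring.
Qed.

(** Expand [(1 + t) ^+ #|K :&: L|] over subsets [J] of [K :&: L], exchange the sums and count the
    sets [L] containing [J]. By [bin_sub_le] the total is at most
    ['C(n, r) * (1 + t * r / n) ^+ r]. *)
Lemma sum_pow_setI (T : finType) (K : {set T}) (r : nat) (t : R) :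
  #|K| = r -> 0 <= t -> (0 < #|T|)%N ->
  \sum_(L : {set T} | #|L| == r) (1 + t) ^+ #|K :&: L|
  <= 'C(#|T|, r)%:R * expR (t * r%:R ^+ 2 / #|T|%:R).
Proof.
move=> cK t0 T0; set n := #|T|; have n0 : 0 < n%:R :> R by rewrite ltr0n.
have rn : (r <= n)%N by rewrite -cK max_card.
have -> : \sum_(L : {set T} | #|L| == r) (1 + t) ^+ #|K :&: L|
   = \sum_(J : {set T} | J \subset K)
       t ^+ #|J| * 'C(n - #|J|, r - #|J|)%:R.
  under eq_bigr => L _ do rewrite -sum_pow_subsets.
  rewrite (exchange_big_dep (fun J : {set T} => J \subset K)) /=; last first.
    by move=> L J _; rewrite subsetI => /andP[].
  apply: eq_bigr => J JK; rewrite -card_supersets; last first.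
    by rewrite -cK subset_leq_card.
  rewrite sumr_const mulr_natr; congr (_ *+ _); apply: eq_card => L.
  by rewrite [RHS]inE unfold_in /= subsetI JK andbC.
apply: le_trans (_ : 'C(n, r)%:R * (1 + t * (r%:R / n%:R)) ^+ r <= _); last first.
  rewrite ler_wpM2l // -/n.
  have -> : t * r%:R ^+ 2 / n%:R = r%:R * (t * (r%:R / n%:R)) by field; rewrite gt_eqF.
  rewrite expRM_natl lerXn2r ?nnegrE ?expR_ge0 ?expR_ge1Dx //.
  by rewrite addr_ge0 // mulr_ge0 // divr_ge0.
rewrite -[X in _ ^+ X]cK -sum_pow_subsets mulr_sumr; apply: ler_sum => J JK.
rewrite exprMn mulrCA ler_wpM2l ?exprn_ge0 //.
rewrite expr_div_n mulrA ler_pdivlMr ?exprn_gt0 // -!natrX -!natrM ler_nat.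
by apply: bin_sub_le => //; rewrite -cK subset_leq_card.
Qed.

(** The symmetric difference with [K] is an involution, so the sum is at most the sum of [t ^+ #|J|]
    over all [J], which is [(1 + t) ^+ #|T|]. *)
Lemma sum_pow_symdiff (T : finType) (K : {set T}) (r : nat) (t : R) : 0 <= t ->
  \sum_(L : {set T} | #|L| == r) t ^+ #|(K :\: L) :|: (L :\: K)| <= expR (#|T|%:R * t).
Proof.
move=> t0; set sd := fun L : {set T} => (K :\: L) :|: (L :\: K).
have sdK : involutive sd.
  by move=> L; apply/setP => i; rewrite !inE; case: (i \in K); case: (i \in L).
apply: le_trans (_ : \sum_(L : {set T}) t ^+ #|sd L| <= _).
  rewrite [X in _ <= X](bigID (fun L : {set T} => #|L| == r)) /= lerDl.
  by apply: sumr_ge0 => L _; rewrite exprn_ge0.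
rewrite (reindex_inj (inv_inj sdK)) /= (eq_bigr (fun J : {set T} => t ^+ #|J|)); last first.
  by move=> L _; rewrite sdK.
have := sum_pow_subsets [set: T] t; rewrite cardsT => E.
rewrite (eq_bigl (fun J : {set T} => J \subset [set: T])); last first.
  by move=> J; rewrite subsetT.
rewrite E expRM_natl lerXn2r ?nnegrE ?expR_ge0 ?expR_ge1Dx //.
by rewrite addr_ge0.
Qed.

End Counting.

(** * First and second moments of the number of dominating sets *)

Section SecondMoment.
Variables (R : realType) (n : nat) (p : R).
Hypotheses (p_ge0 : 0 <= p) (p_le1 : p <= 1).
Implicit Types (K L : {set 'I_n}) (E : {set {set 'I_n}}).
Local Notation q := (1 - p).
Local Notation Ex := (expect p (vertex_pairs n)).

Lemma dominating_sub E K L : K \subset L -> dominating E K -> dominating E L.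
Proof.
move=> KL /forallP D; apply/forallP => v; apply/implyP => vL.
have /implyP/(_ (contra (subsetP KL v) vL))/exists_inP[u uK uE] := D v.
by apply/exists_inP; exists u => //; apply: (subsetP KL).
Qed.

Lemma dominatingT E : dominating E [set: 'I_n].
Proof. by apply/forallP => v; rewrite inE. Qed.

Lemma superset_card (k : nat) K : (#|K| <= k <= n)%N ->
  exists2 L : {set 'I_n}, K \subset L & #|L| = k.
Proof.
move=> /andP[Kk kn].
suff : (0 < #|[set L : {set 'I_n} | K \subset L & #|L| == k]|)%N.
  by case/card_gt0P => L; rewrite inE => /andP[KL /eqP Lk]; exists L.
by rewrite card_supersets // card_ord bin_gt0 leq_sub2r.
Qed.

Lemma domination_number_le E K : dominating E K -> (domination_number E <= #|K|)%N.
Proof.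
move=> D; rewrite /domination_number; case: arg_minnP; first exact: dominatingT.
by move=> M _; apply.
Qed.

Lemma dominating_of_card E k : (domination_number E <= k <= n)%N ->
  exists2 L : {set 'I_n}, dominating E L & #|L| = k.
Proof.
rewrite /domination_number; case: arg_minnP; first exact: dominatingT.
move=> K KD _ /superset_card[L KL Lk]; exists L => //.
exact: dominating_sub KL KD.
Qed.

Definition dom_count (k : nat) E : R := \sum_(K : {set 'I_n} | #|K| == k) (dominating E K)%:R.
Definition dom_mean (k : nat) : R := 'C(n, k)%:R * (1 - q ^+ k) ^+ (n - k).

Lemma dom_count_ge0 k E : 0 <= dom_count k E.
Proof. by apply: sumr_ge0. Qed.

Lemma expect_dom_count k : Ex (dom_count k) = dom_mean k.
Proof.
rewrite /dom_count expect_sum (eq_bigr (fun=> (1 - q ^+ k) ^+ (n - k))); last first.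
  by move=> K /eqP <-; rewrite expect_dominating.
rewrite sumr_const /dom_mean mulr_natl; congr (_ *+ _).
rewrite -[in RHS](card_ord n) -cardsT -cards_draws; apply: eq_card => L.
by rewrite inE subsetT.
Qed.

Lemma dom_count_lt1 k E : (k <= n)%N -> (k < domination_number E)%N -> dom_count k E = 0.
Proof.
move=> kn kD; apply: big1 => K /eqP Kk; case: (boolP (dominating E K)) => // D.
by have := domination_number_le D; rewrite Kk leqNgt kD.
Qed.

Lemma dom_count_ge1 k E : (domination_number E <= k <= n)%N -> 1 <= dom_count k E.
Proof.
move=> /dominating_of_card[L D Lk]; rewrite /dom_count (bigD1 L) ?Lk //= D lerDl.
exact: sumr_ge0.
Qed.

Lemma Gnp_probE (A : pred {set {set 'I_n}}) : Gnp_prob p A = Ex (fun E => (A E)%:R).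
Proof.
rewrite /Gnp_prob /expect big_mkcondr /=; apply: eq_bigr => E _.
by case: (A E); rewrite ?mulr1 ?mulr0.
Qed.

Lemma Gnp_prob_le1 (A : pred {set {set 'I_n}}) : Gnp_prob p A <= 1.
Proof.
rewrite Gnp_probE -[leRHS](expect1 p (vertex_pairs n)); apply: le_expect => // E.
by case: (A E).
Qed.

(** Markov and Chebyshev in one pointwise inequality: the indicator of the event is at least
    [1 - X - (Y / m - 1) ^+ 2], where [X] counts the dominating sets of size [k.-1] and [Y] those of
    size [k.+1]. If the domination number is below [k] then [X >= 1]; if it exceeds [k.+1] then
    [Y = 0]. *)
Lemma two_point_prob (k : nat) (B : R) : (0 < k)%N -> (k < n)%N -> 0 < dom_mean k.+1 ->
  Ex (fun E => dom_count k.+1 E ^+ 2) <= B * dom_mean k.+1 ^+ 2 ->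
  2 - dom_mean k.-1 - B <=
  Gnp_prob p (fun E => ((domination_number E)%:Z == k%:Z)
                    || ((domination_number E)%:Z == k%:Z + 1)).
Proof.
move=> k0 kn m0 HB; set m := dom_mean k.+1 in m0 HB *.
have key : Ex (fun E => 1 - dom_count k.-1 E - (m^-1 * dom_count k.+1 E - 1) ^+ 2)
   = 2 - dom_mean k.-1 - m^-2 * Ex (fun E => dom_count k.+1 E ^+ 2).
  rewrite expectB expectB expect1 expect_dom_count.
  have -> : Ex (fun E => (m^-1 * dom_count k.+1 E - 1) ^+ 2)
    = Ex (fun E => m^-2 * dom_count k.+1 E ^+ 2 - 2 * m^-1 * dom_count k.+1 E + 1).
    by apply: eq_expect => E; field; rewrite gt_eqF.
  by rewrite expectD expectB !expectZ expect1 expect_dom_count -/m; field; rewrite gt_eqF.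
apply: (@le_trans _ _ (2 - dom_mean k.-1 - m^-2 * Ex (fun E => dom_count k.+1 E ^+ 2))).
  by rewrite lerD2l lerN2 mulrC ler_pdivrMr ?exprn_gt0.
rewrite -key Gnp_probE; apply: le_expect => // E.
have [gk|gk] := leqP (domination_number E) k.-1.
  have := dom_count_ge1 (k := k.-1) (E := E).
  rewrite gk (leq_trans (leq_pred _) (ltnW kn)) => /(_ isT) H.
  apply: le_trans (_ : 0 <= _); last by rewrite ler0n.
  by have := sqr_ge0 (m^-1 * dom_count k.+1 E - 1); lra.
have X0 := dom_count_ge0 k.-1 E.
have [gk2|gk2] := leqP (domination_number E) k.+1; last first.
  rewrite (dom_count_lt1 kn gk2) mulr0 sub0r sqrrN expr1n.
  by apply: le_trans (_ : 0 <= _); rewrite ?ler0n //; lra.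
have -> : ((domination_number E)%:Z == k%:Z) || ((domination_number E)%:Z == k%:Z + 1).
  rewrite -(PoszD k 1) !eqz_nat addn1; move: gk gk2; rewrite prednK // (leq_eqVlt _ k.+1) ltnS.
  by move=> gk /orP[->|]; rewrite ?orbT // => gk2; rewrite eqn_leq gk gk2.
by have := sqr_ge0 (m^-1 * dom_count k.+1 E - 1); move: X0 => /=; lra.
Qed.

End SecondMoment.

(** * Explicit bounds for the pair probability *)

Section PairRatio.
Variables (R : realType) (n : nat) (p : R).
Hypotheses (p_ge0 : 0 <= p) (p_le1 : p <= 1).
Local Notation q := (1 - p).
Local Notation Ex := (expect p (vertex_pairs n)).
Variables (r : nat).
Hypotheses (r_gt0 : (0 < r)%N) (x_lt1 : q ^+ r < 1).
Variables (K L : {set 'I_n}).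
Hypotheses (cK : #|K| = r) (cL : #|L| = r).
Local Notation s := #|K :&: L|.
Local Notation a := (r - s)%N.

Lemma card_overlap_le : (s <= r)%N.
Proof. by rewrite -cK subset_leq_card ?subsetIl. Qed.

Lemma card_union_le : (r + a <= n)%N.
Proof. by rewrite -(card_KUL cK cL) -[leqRHS]card_ord max_card. Qed.

Lemma card_outside : (n - r = n - (r + a) + a)%N.
Proof.
have ran := card_union_le.
have rn : (r <= n)%N := leq_trans (leq_addr _ _) ran.
by rewrite subnDA subnK // -(leq_add2l r) subnKC.
Qed.

(** Meant for [L] close to [K]: [cols] is bounded by 1, and each outside vertex uses [1 - 2 * x + x
    * y <= (1 - x) * (1 - x * (1 - y))]. *)
Lemma expect_pair_near :
  Ex (fun E => (dominating E K)%:R * (dominating E L)%:R)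
  <= (1 - q ^+ r) ^+ (n - r) * expR (- (q ^+ r * (1 - q ^+ a) * (n - (r + a))%:R)).
Proof.
have q_ge0 : 0 <= q by rewrite subr_ge0.
have q_le1 : q <= 1 by rewrite lerBlDr lerDl.
have x_lt1' := x_lt1; set x := q ^+ r in x_lt1' *; set y := q ^+ a.
have x0 : 0 <= x by apply: exprn_ge0.
have y0 : 0 <= y by apply: exprn_ge0.
have y1 : y <= 1 by apply: exprn_ile1.
have xy : x <= y by apply: ler_wiXn2l => //; apply: leq_subr.
have step0 : 0 <= 1 - 2 * x + x * y by have := sqr_ge0 (1 - x); nra.
rewrite (expect_pair p cK cL) exprD -/x -/y.
rewrite card_outside exprD [X in X * expR _]mulrC -[leRHS]mulrA [leLHS]mulrC; apply: ler_pM.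
- by apply: expect_ge0 => // E; rewrite mulr_ge0 ?rows_ge0 ?cols_ge0.
- exact: exprn_ge0.
- rewrite /x -(expect_rows p cK cL); apply: le_expect => // E.
  rewrite -[leRHS]mulr1 ler_wpM2l ?rows_ge0 //; apply: prodr_ile1 => v _.
  by rewrite hit_ge0 hit_le1.
- set k := (n - (r + a))%N.
  have -> : - (x * (1 - y) * k%:R) = k%:R * (- (x * (1 - y))) by ring.
  rewrite expRM_natl -exprMn lerXn2r ?nnegrE //; first last.
  + apply: le_trans (_ : (1 - x) * (1 + - (x * (1 - y))) <= _); first by nra.
    by rewrite ler_wpM2l ?expR_ge1Dx // subr_ge0 ltW.
  + by rewrite mulr_ge0 ?expR_ge0 // subr_ge0 ltW.
Qed.

Lemma expect_pair_ratio :
  Ex (fun E => (dominating E K)%:R * (dominating E L)%:R)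
  <= ((1 - q ^+ r) ^+ (n - r)) ^+ 2 *
     expR ((n%:R * (q ^+ (r + a) * (1 - q ^+ s)) + r%:R ^+ 2 * p * q ^+ (2 * r).-1)
           / (1 - q ^+ r) ^+ 2).
Proof.
have q_ge0 : 0 <= q by rewrite subr_ge0.
have q_le1 : q <= 1 by rewrite lerBlDr lerDl.
have sr := card_overlap_le.
rewrite (expect_pair p cK cL).
have x_lt1' := x_lt1; set x := q ^+ r in x_lt1' *.
have x0 : 0 <= x by apply: exprn_ge0.
have w0 : 0 <= q ^+ r.-1 by apply: exprn_ge0.
have w1 : q ^+ r.-1 <= 1 by apply: exprn_ile1.
have xw : x = q * q ^+ r.-1 by rewrite -exprS prednK.
have x1 : 0 < 1 - x by rewrite subr_gt0.
pose z := q * (1 - q ^+ r.-1) / (1 - x).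
have z_ge0 : 0 <= z by rewrite divr_ge0 ?(ltW x1) // mulr_ge0 // subr_ge0.
have zE : z * (1 - x) = q * (1 - q ^+ r.-1) by rewrite /z divfK ?gt_eqF.
(* The relative amount by which conditioning on a nonempty row lowers the probability that an entry
   is missing: [z = q * (1 - b)]. *)
pose b := p * q ^+ r.-1 / (1 - x).
have b0 : 0 <= b by rewrite divr_ge0 ?(ltW x1) // mulr_ge0.
have zb : z = q * (1 - b).
  by rewrite /z /b; apply: (mulIf (x := 1 - x)); rewrite ?gt_eqF // divfK ?gt_eqF // xw;
     field; rewrite -xw gt_eqF.
have b1 : b <= 1.
  by rewrite ler_pdivrMr // mul1r xw; nra.
have sa1 : q ^+ s * q ^+ a = x by rewrite -exprD subnKC.
have zle : z ^+ a <= q ^+ a by rewrite lerXn2r ?nnegrE // zb; nra.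
have sz1 : q ^+ s * z ^+ a <= x.
  by rewrite -sa1 ler_wpM2l // exprn_ge0.
have bip := expect_rows_cols p_ge0 p_le1 cK cL x_lt1 z_ge0 zE
  (le_trans sz1 (ltW x_lt1')) (subxx _).
rewrite (card_LDK K cL) in bip.
set k := (n - (r + a))%N.
set D := (1 - x) ^+ 2; have D0 : 0 < D by rewrite exprn_gt0.
pose T1 := q ^+ (r + a) * (1 - q ^+ s) / D.
pose T2 := a%:R * p * q ^+ (2 * r).-1 / D.
have qra : q ^+ (r + a) * q ^+ s = x ^+ 2.
  by rewrite -exprD -addnA subnK // exprD expr2.
(* By [qra] the left side equals [D + q ^+ (r + a) * (1 - q ^+ s)], that is [D * (1 + T1)]. *)
have step1 : 1 - 2 * x + q ^+ (r + a) <= D * expR T1.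
  apply: le_trans (_ : D * (1 + T1) <= _); last by rewrite ler_pM2l // expR_ge1Dx.
  rewrite /T1 mulrDr mulr1 mulrCA divff ?gt_eqF // mulr1 mulrBr qra /D.
  by rewrite le_eqVlt; apply/orP; left; apply/eqP; ring.
have step1' : 0 <= 1 - 2 * x + q ^+ (r + a).
  have : x ^+ 2 <= q ^+ (r + a).
    by rewrite -qra ler_piMr ?exprn_ge0 ?exprn_ile1.
  by have := sqr_ge0 (1 - x); nra.
have step2 : 1 - q ^+ s * z ^+ a <= (1 - x) * expR T2.
  apply: le_trans (_ : (1 - x) * (1 + T2) <= _); last by rewrite ler_pM2l // expR_ge1Dx.
  have bern : 1 - a%:R * b <= (1 - b) ^+ a by apply: bernoulli_ineq; rewrite b0.
  have -> : q ^+ s * z ^+ a = x * (1 - b) ^+ a by rewrite zb exprMn mulrA sa1.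
  have -> : (1 - x) * (1 + T2) = 1 - x + x * (a%:R * b).
    rewrite mulrDr mulr1; congr (_ + _).
    rewrite /T2; have -> : (2 * r).-1 = (r + r.-1)%N.
      by rewrite mul2n -addnn -{2}(prednK r_gt0) addnS.
    by rewrite /b /D exprD -/x; field; rewrite gt_eqF.
  by nra.
have T10 : 0 <= T1.
  by rewrite divr_ge0 ?(ltW D0) // mulr_ge0 ?exprn_ge0 // subr_ge0 exprn_ile1.
have T20 : 0 <= T2.
  by rewrite divr_ge0 ?(ltW D0) // !mulr_ge0 ?exprn_ge0.
apply: le_trans (_ : (D * expR T1) ^+ k * ((1 - x) ^+ a * ((1 - x) * expR T2) ^+ a) <= _).
  apply: ler_pM.
  - exact: exprn_ge0.
  - by apply: expect_ge0 => // E; rewrite mulr_ge0 ?rows_ge0 ?cols_ge0.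
  - by rewrite lerXn2r ?nnegrE // mulr_ge0 ?expR_ge0 // ltW.
  - apply: le_trans bip _; rewrite ler_wpM2l ?exprn_ge0 ?(ltW x1) //.
    rewrite lerXn2r ?nnegrE //; last by rewrite mulr_ge0 ?expR_ge0 // ltW.
    by rewrite subr_ge0 (le_trans sz1) // ltW.
have -> : (D * expR T1) ^+ k * ((1 - x) ^+ a * ((1 - x) * expR T2) ^+ a)
   = ((1 - x) ^+ (n - r)) ^+ 2 * expR (k%:R * T1 + a%:R * T2).
  rewrite expRD !expRM_natl card_outside -/k exprD /D !exprMn.
  move: ((1 - x) ^+ k) ((1 - x) ^+ a) (expR T1 ^+ k) (expR T2 ^+ a) => *; ring.
rewrite ler_wpM2l ?exprn_ge0 ?(ltW x1) // ler_expR.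
rewrite mulrDl lerD //.
  by rewrite -mulrA ler_wpM2r // ler_nat leq_subr.
rewrite /T2 !mulrA ler_wpM2r ?invr_ge0 ?(ltW D0) // ler_wpM2r ?exprn_ge0 //.
by rewrite ler_wpM2r // -expr2 lerXn2r ?nnegrE // ler_nat leq_subr.
Qed.

End PairRatio.

(** Each pair satisfies one of three bounds, and the sum of all three then bounds every pair, so the
    sums over [L] run over all [r]-sets. The first two use [sum_pow_setI]. The third uses
    [sum_pow_symdiff], as the symmetric difference has [2 * (r - #|K :&: L|)] elements. *)
Lemma second_moment_regions (R : realType) (n r : nat) (p c1 c2 t1 t2 t : R) :
  0 <= p <= 1 -> (0 < n)%N -> (r <= n)%N ->
  0 <= c1 -> 0 <= c2 -> 0 <= t1 -> 0 <= t2 -> 0 <= t ->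
  let P := (1 - (1 - p) ^+ r) ^+ (n - r) in
  0 < P ->
  (forall K L : {set 'I_n}, #|K| = r -> #|L| = r ->
    let J := expect p (vertex_pairs n) (fun E => (dominating E K)%:R * (dominating E L)%:R) in
    [\/ J <= P ^+ 2 * (c1 * (1 + t1) ^+ #|K :&: L|),
        J <= P ^+ 2 * (c2 * (1 + t2) ^+ #|K :&: L|) |
        J <= P * (t ^+ 2) ^+ (r - #|K :&: L|)]) ->
  expect p (vertex_pairs n) (fun E => dom_count R r E ^+ 2)
  <= (c1 * expR (t1 * r%:R ^+ 2 / n%:R) + c2 * expR (t2 * r%:R ^+ 2 / n%:R)
      + expR (n%:R * t) / dom_mean n p r) * dom_mean n p r ^+ 2.
Proof.
move=> /andP[p0 p1] n0 rn c10 c20 t10 t20 t0 P P0 H.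
have C0 : 0 < 'C(n, r)%:R :> R by rewrite ltr0n bin_gt0.
set m := dom_mean n p r; have mE : m = 'C(n, r)%:R * P by [].
have m0 : 0 < m by rewrite mE mulr_gt0.
have -> : expect p (vertex_pairs n) (fun E => dom_count R r E ^+ 2)
  = \sum_(K : {set 'I_n} | #|K| == r) \sum_(L : {set 'I_n} | #|L| == r)
      expect p (vertex_pairs n) (fun E => (dominating E K)%:R * (dominating E L)%:R).
  under eq_bigr => K _ do rewrite -expect_sum.
  rewrite -expect_sum; apply: eq_expect => E.
  by rewrite expr2 {1}/dom_count mulr_suml; apply: eq_bigr => K _; rewrite mulr_sumr.
set e1 := expR (t1 * _ / _); set e2 := expR (t2 * _ / _); set e3 := expR (_ * t).
apply: le_trans (_ : \sum_(K : {set 'I_n} | #|K| == r)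
   (P ^+ 2 * (c1 * ('C(n, r)%:R * e1)) + P ^+ 2 * (c2 * ('C(n, r)%:R * e2)) + P * e3) <= _).
  apply: ler_sum => K /eqP cK.
  have s1 : \sum_(L : {set 'I_n} | #|L| == r) (1 + t1) ^+ #|K :&: L| <= 'C(n, r)%:R * e1.
    by have := sum_pow_setI cK t10; rewrite card_ord; apply.
  have s2 : \sum_(L : {set 'I_n} | #|L| == r) (1 + t2) ^+ #|K :&: L| <= 'C(n, r)%:R * e2.
    by have := sum_pow_setI cK t20; rewrite card_ord; apply.
  have s3 : \sum_(L : {set 'I_n} | #|L| == r) t ^+ #|(K :\: L) :|: (L :\: K)| <= e3.
    by have := sum_pow_symdiff K r t0; rewrite card_ord.
  have := lerD (lerD (ler_wpM2l (mulr_ge0 (sqr_ge0 P) c10) s1)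
            (ler_wpM2l (mulr_ge0 (sqr_ge0 P) c20) s2)) (ler_wpM2l (ltW P0) s3).
  rewrite -!mulrA; apply: le_trans.
  rewrite !mulr_sumr -!big_split /=; apply: ler_sum => L /eqP cL.
  have -> : #|(K :\: L) :|: (L :\: K)| = (2 * (r - #|K :&: L|))%N.
    have -> : #|(K :\: L) :|: (L :\: K)| = (#|K :\: L| + #|L :\: K|)%N.
      apply/eqP; rewrite (leq_card_setU (K :\: L) (L :\: K)) disjoints_subset.
      by apply/subsetP => i; rewrite !inE negb_and negbK => /andP[_ ->].
    by rewrite (card_KDL L cK) (card_LDK K cL) mul2n addnn.
  rewrite exprM.
  have [u1 u2] : 0 <= 1 + t1 /\ 0 <= 1 + t2 by split; lra.
  have PP := sqr_ge0 P.
  have h1 : 0 <= P ^+ 2 * (c1 * (1 + t1) ^+ #|K :&: L|).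
    exact: mulr_ge0 PP (mulr_ge0 c10 (exprn_ge0 _ u1)).
  have h2 : 0 <= P ^+ 2 * (c2 * (1 + t2) ^+ #|K :&: L|).
    exact: mulr_ge0 PP (mulr_ge0 c20 (exprn_ge0 _ u2)).
  have h3 : 0 <= P * (t ^+ 2) ^+ (r - #|K :&: L|).
    exact: mulr_ge0 (ltW P0) (exprn_ge0 _ (sqr_ge0 t)).
  by case: (H K L cK cL) => /=; lra.
rewrite sumr_const.
have -> : #|[pred K : {set 'I_n} | #|K| == r]| = 'C(n, r).
  rewrite -[in RHS](card_ord n) -cardsT -cards_draws; apply: eq_card => L.
  by rewrite !inE subsetT.
rewrite -mulr_natr le_eqVlt; apply/orP; left; apply/eqP.
by rewrite mE; field; rewrite !gt_eqF.
Qed.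

(** * Estimates *)

Section RealFacts.
Variable R : realType.
Implicit Types (x d q p : R) (m : nat).

Lemma pow_one_sub_le x m : x <= 1 -> (1 - x) ^+ m <= expR (- (m%:R * x)).
Proof.
move=> x1; rewrite -mulrN expRM_natl lerXn2r ?nnegrE ?expR_ge0 ?expR_ge1Dx //.
by rewrite subr_ge0.
Qed.

Lemma pow_one_sub_ge x m : 0 <= x <= 1 / 2 -> expR (- (2 * m%:R * x)) <= (1 - x) ^+ m.
Proof.
move=> /andP[x0 x1]; have -> : - (2 * m%:R * x) = m%:R * (- (2 * x)) by ring.
rewrite expRM_natl lerXn2r ?nnegrE ?expR_ge0 //; first by lra.
rewrite expRN -[leRHS]invrK lef_pV2 ?posrE ?expR_gt0 ?invr_gt0; try lra.
apply: le_trans (expR_ge1Dx _); rewrite -[leLHS]mul1r ler_pdivrMr; first by nra.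
by lra.
Qed.

(* [1 / q <= 1 + 4 p <= exp (4 p)] *)
Lemma pow_compl_ge p m : 0 <= p <= 3 / 4 -> expR (- (4 * p * m%:R)) <= (1 - p) ^+ m.
Proof.
move=> /andP[p0 p1]; have -> : - (4 * p * m%:R) = m%:R * (- (4 * p)) by ring.
rewrite expRM_natl lerXn2r ?nnegrE ?expR_ge0 //; first by lra.
rewrite expRN -[leRHS]invrK lef_pV2 ?posrE ?expR_gt0 ?invr_gt0; try lra.
apply: le_trans (expR_ge1Dx _); rewrite -[leLHS]mul1r ler_pdivrMr; first by nra.
by lra.
Qed.

Lemma expR1_ge2 : 2 <= expR (1 : R).
Proof. by have := expR_ge1Dx (1 : R); lra. Qed.

Lemma expR1_le4 : expR (1 : R) <= 4.
Proof.
have : 1 / 4 <= expR (- 1 : R).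
  have -> : (- 1 : R) = 2%:R * (- (1 / 2)) by field.
  rewrite expRM_natl; have := expR_ge1Dx (- (1 / 2) : R).
  move: (expR _) => e he; nra.
rewrite expRN => H.
rewrite -[leLHS]invrK -[leRHS]invrK lef_pV2 ?posrE ?invr_gt0 ?expR_gt0 //; lra.
Qed.

Lemma expRB1_le d : 0 <= d <= 1 / 2 -> expR d - 1 <= 2 * d.
Proof.
move=> /andP[d0 d1]; have := expR_ge1Dx (- d); rewrite expRN.
have e0 := expR_gt0 d; move: (expR d) e0 => e e0 H.
have : e * (1 - d) <= 1 by rewrite -ler_pdivlMl // mulr1.
nra.
Qed.

(** From [expR t >= 1 + t] the right side is at least [t / (1 + t)], and [1 + t <= 7]. *)
Lemma one_sub_exp_ge (t : R) : 0 <= t <= 6 -> t / 7 <= 1 - expR (- t).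
Proof.
move=> /andP[t0 t6]; have := expR_ge1Dx t; rewrite expRN.
have e0 := expR_gt0 t; move: (expR t) e0 => e e0 H.
have : e^-1 <= (1 + t)^-1 by rewrite lef_pV2 ?posrE //; lra.
move=> H2; apply: (@le_trans _ _ (1 - (1 + t)^-1)); last by lra.
have u0 : 0 < 1 + t by lra.
have -> : 1 - (1 + t)^-1 = t / (1 + t) by field; rewrite gt_eqF.
by rewrite ler_wpM2l // lef_pV2 ?posrE //; lra.
Qed.

Lemma succ_mul_pow_le q m : 0 <= q <= 1 / 2 -> m.+1%:R * q ^+ m.+1 <= q.
Proof.
move=> /andP[q0 q1].
suff H : m.+1%:R * q ^+ m <= 1.
  rewrite exprS mulrCA -[leRHS]mulr1; exact: ler_wpM2l.
elim: m => [|m IH]; first by rewrite expr0 mulr1.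
have m0 : 0 <= m%:R :> R by [].
have qm : 0 <= q ^+ m by rewrite exprn_ge0.
rewrite exprS; rewrite -!natr1 in IH *; nra.
Qed.

End RealFacts.

(** * The threshold size [k], with [l] standing for the logarithm of [n] *)

Section Threshold.
Variables (R : realType) (n : nat) (p l : R).
Hypotheses (p_le1 : p <= 1) (nE : n%:R = expR l) (l_big : 10 ^+ 6 <= l)
  (l_exp : l ^+ 4 <= expR (l / 16)) (p_big : l ^+ 3 * expR (- (2 / 3 * l)) <= p).
Local Notation q := (1 - p).
Local Notation N := (n%:R : R).

Lemma log_gt0 : 0 < l.
Proof. by apply: lt_le_trans l_big; rewrite exprn_gt0. Qed.

Lemma p_gt0 : 0 < p.
Proof. by apply: lt_le_trans p_big; rewrite mulr_gt0 ?expR_gt0 ?exprn_gt0 ?log_gt0. Qed.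

Lemma N_gt0 : 0 < N. Proof. by rewrite nE expR_gt0. Qed.

Lemma log4_le_exp (c : R) : 1 / 16 <= c -> l ^+ 4 <= expR (c * l).
Proof.
have l0 := log_gt0; move=> c16; apply: le_trans l_exp _; rewrite ler_expR.
by nra.
Qed.

Lemma pN_ge : l ^+ 3 * expR (1 / 3 * l) <= p * N.
Proof.
have -> : l ^+ 3 * expR (1 / 3 * l) = l ^+ 3 * expR (- (2 / 3 * l)) * N.
  by rewrite nE -[RHS]mulrA -expRD; congr (_ * expR _); field.
by rewrite ler_wpM2r ?(ltW N_gt0).
Qed.

Lemma pN_ge7 : l ^+ 7 <= p * N.
Proof.
apply: le_trans pN_ge; rewrite -[7%N]/(3 + 4)%N exprD.
by rewrite ler_wpM2l ?exprn_ge0 ?(ltW log_gt0) // log4_le_exp //; lra.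
Qed.

(** The cube of the lower bound on [p]: the exponent 2/3 makes the powers of [n] cancel exactly. *)
Lemma p3N2_ge : l ^+ 9 <= p ^+ 3 * N ^+ 2.
Proof.
have -> : l ^+ 9 = (l ^+ 3 * expR (- (2 / 3 * l))) ^+ 3 * N ^+ 2.
  have E : expR (- (2 / 3 * l)) ^+ 3 * expR l ^+ 2 = 1.
    by rewrite -(expRM_natl 3) -(expRM_natl 2) -expRD -[RHS]expR0; congr expR; field.
  by rewrite nE [(_ * _) ^+ 3]exprMn -[RHS]mulrA E mulr1 -exprM.
rewrite ler_wpM2r ?exprn_ge0 ?(ltW N_gt0) // lerXn2r ?nnegrE ?(ltW p_gt0) //.
by rewrite mulr_ge0 ?expR_ge0 ?exprn_ge0 ?(ltW log_gt0).
Qed.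

Lemma q_pow_le (m : nat) : q ^+ m <= expR (- (p * m%:R)).
Proof. by rewrite mulrC; apply: pow_one_sub_le. Qed.

Lemma exists_threshold : exists k : nat, [/\ (0 < k)%N, (k < n)%N,
  dom_mean n p k.-1 < 1 / l, 1 / l <= dom_mean n p k & p * k%:R <= 2 * l + p].
Proof.
have [l0 p0 N0 P7] := And4 log_gt0 p_gt0 N_gt0 pN_ge7.
have l1 : 64 <= l by move: l_big; lra.
have P1 := p_le1; have q0 : 0 <= q by lra. have q1 : q <= 1 by lra.
have n0 : (0 < n)%N by rewrite -(ltr0n R).
(* This size satisfies [p * r0 >= 2 * l], so [q ^+ r0 <= 1 / N ^+ 2] and a fixed [r0]-set dominates
   with probability at least 1/2. Hence the least admissible [k] is at most [r0]. *)
pose r0 := (Num.trunc (2 * l / p)).+1.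
have lp0 : 0 <= 2 * l / p by rewrite divr_ge0 ?(ltW p0) // mulr_ge0 ?(ltW l0).
have /andP[t1 t2] := trunc_itv lp0.
have r0_le : p * r0%:R <= 2 * l + p.
  by rewrite /r0 -natr1 mulrDr mulr1 lerD2r mulrC -ler_pdivlMr.
have r0_ge : 2 * l <= p * r0%:R by rewrite [p * _]mulrC -ler_pdivrMr // ltW.
have l67 : 64 * l <= l ^+ 7.
  rewrite exprSr ler_wpM2r ?(ltW l0) //.
  have l1' : 1 <= l by lra.
  by apply: le_trans l1 _; rewrite ler_eXnr.
have r0_lt : (r0 < n)%N.
  rewrite -(ltr_nat R) -(ltr_pM2l p0); apply: le_lt_trans r0_le _.
  by lra.
have q_lt1 : q < 1 by lra.
(* The empty set does not dominate, which forces [k > 0] and gives [k.-1] its meaning. *)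
have m0 : dom_mean n p 0 = 0.
  by rewrite /dom_mean subn0 expr0 subrr expr0n gtn_eqF // mulr0.
have m1 : 1 / l <= dom_mean n p r0.
  have qr0 : q ^+ r0 <= 1 / N ^+ 2.
    apply: le_trans (q_pow_le _) _; rewrite nE div1r -(expRM_natl 2) -expRN ler_expR.
    by lra.
  have C1 : 1 <= 'C(n, r0)%:R :> R by rewrite ler1n bin_gt0 ltnW.
  have N2 : 64 <= N.
    by rewrite nE; have := expR_ge1Dx l; lra.
  have qr01 : 0 <= q ^+ r0 <= 1 by rewrite exprn_ge0 // exprn_ile1.
  have B := bernoulli_ineq (n - r0) qr01.
  have H : (n - r0)%:R * q ^+ r0 <= 1 / N.
    apply: (@le_trans _ _ (N * (1 / N ^+ 2))).
      by apply: ler_pM => //; [case/andP: qr01 | rewrite ler_nat leq_subr].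
    by rewrite le_eqVlt; apply/orP; left; apply/eqP; field; rewrite gt_eqF.
  have H2 : 1 / N <= 1 / 4 by rewrite ler_wpM2l // lef_pV2 ?posrE //; lra.
  have H3 : 1 / l <= 1 / 4 by rewrite ler_wpM2l // lef_pV2 ?posrE //; lra.
  have D : 1 / 2 <= (1 - q ^+ r0) ^+ (n - r0) by lra.
  have D2 : 1 / l <= 1 * (1 / 2) by lra.
  by apply: le_trans D2 _; apply: ler_pM => //; lra.
have ex : exists m, 1 / l <= dom_mean n p m by exists r0.
case: (ex_minnP ex) => k kP kmin.
have kr0 : (k <= r0)%N by apply: kmin.
have k0 : (0 < k)%N.
  rewrite lt0n; apply/eqP => k0; move: kP; rewrite k0 m0 leNgt.
  by rewrite divr_gt0.
exists k; split => //.
- exact: leq_ltn_trans kr0 r0_lt.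
- rewrite ltNge; apply/negP => /kmin; rewrite leqNgt prednK // leqnn //.
- apply: le_trans r0_le; rewrite ler_wpM2l ?(ltW p0) // ler_nat //.
Qed.

End Threshold.

Lemma bin_le_exp (n k : nat) : ('C(n, k) <= n ^ k)%N.
Proof.
apply: (@leq_trans (n ^_ k)); first by rewrite -bin_ffact leq_pmulr ?fact_gt0.
elim: k n => // k IH [|n]; first by rewrite ffact0n.
rewrite ffactnS expnS leq_mul2l (leq_trans (IH n)) ?orbT //.
by case: k {IH} => // k; rewrite leq_exp2r.
Qed.

Lemma leq_overlap_mul (s a k : nat) : (0 < s)%N -> (s + a = k.+1)%N -> (k <= s * a.+1)%N.
Proof. by move=> *; nia. Qed.

Lemma leq_double_sub (s k : nat) : (2 * s < k.+1)%N -> (k <= k.+1.*2 - 2 * s)%N.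
Proof. by move=> *; lia. Qed.

(** * Consequences of the threshold for [q ^+ k] and for the means *)

Section Estimates.
Variables (R : realType) (n k : nat) (p l : R).
Hypotheses (p_le1 : p <= 1) (nE : n%:R = expR l) (l_big : 10 ^+ 6 <= l)
  (l_exp : l ^+ 4 <= expR (l / 16)) (p_big : l ^+ 3 * expR (- (2 / 3 * l)) <= p).
Hypotheses (k_gt0 : (0 < k)%N) (k_ltn : (k < n)%N) (mean_k : 1 / l <= dom_mean n p k)
  (pk_le : p * k%:R <= 2 * l + p).
Local Notation q := (1 - p).
Local Notation N := (n%:R : R).
Local Notation r := k.+1.
Local Notation Rr := (r%:R : R).

Let l0 : 0 < l := log_gt0 l_big.
Let p0 : 0 < p := p_gt0 l_big p_big.
Let N0 : 0 < N := N_gt0 nE.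
Let l64 : 64 <= l. Proof. by move: l_big; lra. Qed.

Lemma compl_ge0 : 0 <= q. Proof. by rewrite subr_ge0. Qed.
Lemma compl_le1 : q <= 1. Proof. by rewrite lerBlDr lerDl ltW. Qed.
Let q0 := compl_ge0.
Let q1 := compl_le1.
Let P7 := pN_ge7 nE l_big l_exp p_big.

Lemma log_expS_ge (i : nat) : l ^+ i <= l ^+ i.+1.
Proof. by rewrite exprS ler_peMl ?exprn_ge0 ?(ltW l0) //; move: l64; lra. Qed.

Lemma pr_le : p * Rr <= 4 * l.
Proof. by rewrite -natr1 mulrDr mulr1; move: pk_le p_le1 l64; lra. Qed.

Lemma r_le : 8 * Rr <= N.
Proof.
rewrite -(ler_pM2l p0); apply: le_trans P7.
have h2 : 32 * l <= l ^+ 2.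
  by rewrite expr2 ler_wpM2r ?(ltW l0) //; move: l64; lra.
apply: le_trans (_ : 32 * l <= _); first by move: pr_le; lra.
apply: le_trans h2 _; do 4 (apply: le_trans (log_expS_ge _) _); exact: log_expS_ge.
Qed.

Lemma succ_natr : Rr = k%:R + 1. Proof. by rewrite -natr1. Qed.
Lemma k_ge1 : 1 <= k%:R :> R. Proof. by rewrite ler1n. Qed.

(** The mean at [k] is at least [1 / l >= expR (- (l / 2))] and at most
    [n ^ k * expR (- ((n - k) * q ^+ k))]. Taking logarithms gives
    [(n - k) * q ^+ k <= 3 / 2 * k * l], and [n - k >= 3 / 4 * n]. *)
Lemma xk_le : q ^+ k * N <= 2 * k%:R * l.
Proof.
have xk0 : 0 <= q ^+ k by rewrite exprn_ge0.
have xk1 : q ^+ k <= 1 by rewrite exprn_ile1.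
have C : 'C(n, k)%:R <= expR (k%:R * l).
  by rewrite expRM_natl -nE -natrX ler_nat bin_le_exp.
have e1 : expR (- (l / 2)) <= 1 / l.
  rewrite expRN div1r lef_pV2 ?posrE ?expR_gt0 //.
  have -> : l / 2 = 1 / 2 * l by field.
  apply: le_trans (log4_le_exp l_big l_exp _); last by lra.
  by rewrite -[leLHS]expr1; do 2 (apply: le_trans (log_expS_ge _) _); exact: log_expS_ge.
have : expR (- (l / 2)) <= expR (k%:R * l) * expR (- ((n - k)%:R * q ^+ k)).
  apply: le_trans e1 _; apply: le_trans mean_k _; apply: ler_pM => //.
    by rewrite exprn_ge0 // subr_ge0.
  exact: pow_one_sub_le.
rewrite -expRD ler_expR (natrB _ (ltnW k_ltn)).
move: k_ge1 r_le; rewrite succ_natr.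
move: (q ^+ k) xk0 xk1 (k%:R) => x x0 x1 K K1 KN H.
have h1 : (N - K) * x <= 3 / 2 * (K * l).
  have : l <= K * l by rewrite ler_peMl // ltW.
  by lra.
have : 3 / 4 * N * x <= (N - K) * x by rewrite ler_wpM2r //; lra.
by lra.
Qed.

Lemma xk_le_r : q ^+ k * N <= 2 * Rr * l.
Proof.
by apply: le_trans xk_le _; rewrite ler_wpM2r ?(ltW l0) // ler_wpM2l // ler_nat.
Qed.

Lemma xk_pN_le : q ^+ k * (p * N) <= 8 * l ^+ 2.
Proof.
rewrite mulrCA; apply: le_trans (ler_wpM2l (ltW p0) xk_le_r) _.
have := ler_wpM2r (ltW l0) pr_le; rewrite expr2; lra.
Qed.

Lemma xk_le_exp : q ^+ k <= expR (- (1 / 4 * l)).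
Proof.
have A := pN_ge nE p_big.
have xk0 : 0 <= q ^+ k by rewrite exprn_ge0.
have e0 := expR_gt0 (1 / 4 * l).
rewrite expRN -div1r ler_pdivlMr // -(ler_pM2r (exprn_gt0 2 l0)).
have l8 : 8 * (q ^+ k * expR (1 / 4 * l) * l ^+ 2) <= q ^+ k * (p * N).
  rewrite [leLHS](_ : _ = q ^+ k * (8 * (expR (1 / 4 * l) * l ^+ 2))); last by ring.
  rewrite ler_wpM2l //; apply: le_trans A.
  rewrite [l ^+ 3]exprS -[leRHS]mulrA; apply: ler_pM => //.
  - by rewrite mulr_ge0 ?exprn_ge0 ?(ltW e0) ?(ltW l0).
  - by move: l64; lra.
  - by rewrite mulrC ler_wpM2l ?exprn_ge0 ?(ltW l0) // ler_expR ler_wpM2r ?(ltW l0) //; lra.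
have h8 : 0 < 8 :> R by lra.
by rewrite -(ler_pM2l h8) [1 * _ ^+ _]mul1r; apply: le_trans l8 xk_pN_le.
Qed.

Lemma xk_le8 : q ^+ k <= 1 / 8.
Proof.
apply: le_trans xk_le_exp _; rewrite expRN -div1r ler_wpM2l // lef_pV2 ?posrE ?expR_gt0 //.
by have := expR_ge1Dx (1 / 4 * l); move: l64; lra.
Qed.

Lemma xr_le_xk : q ^+ r <= q ^+ k.
Proof. by rewrite exprS ler_piMl ?exprn_ge0. Qed.

Lemma xr_lt1 : q ^+ r < 1.
Proof. by move: xr_le_xk xk_le8; lra. Qed.

(* The contribution of the bipartite graph between [K :\: L] and [L :\: K]. *)
Lemma bipartite_le : Rr ^+ 2 * p * q ^+ (2 * r).-1 <= 1 / l ^+ 2.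
Proof.
have Y1 : Rr ^+ 2 * p * q ^+ (2 * r).-1 <= Rr ^+ 2 * p * (q ^+ k) ^+ 2.
  rewrite ler_wpM2l ?mulr_ge0 ?exprn_ge0 ?(ltW p0) // -exprM; apply: ler_wiXn2l => //.
  by rewrite mul2n muln2 doubleS.
apply: le_trans Y1 _; have pN := p3N2_ge nE l_big p_big.
(* The product is [(p * r) ^+ 2 * p ^+ 2 * (q ^+ k * N) ^+ 2], to which [xk_le_r] and [pr_le] apply;
   dividing by [p ^+ 3 * N ^+ 2 >= l ^+ 9] leaves at most [2 ^+ 10 / l ^+ 3]. *)
have Y2 : Rr ^+ 2 * p * (q ^+ k) ^+ 2 * (p ^+ 3 * N ^+ 2) <= 2 ^+ 10 * l ^+ 6.
  have -> : Rr ^+ 2 * p * (q ^+ k) ^+ 2 * (p ^+ 3 * N ^+ 2)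
     = (p * Rr) ^+ 2 * p ^+ 2 * (q ^+ k * N) ^+ 2 by ring.
  apply: le_trans (_ : (p * Rr) ^+ 2 * p ^+ 2 * (2 * Rr * l) ^+ 2 <= _).
    rewrite ler_wpM2l ?mulr_ge0 ?exprn_ge0 ?mulr_ge0 ?(ltW p0) //.
    rewrite lerXn2r ?nnegrE ?xk_le_r // ?mulr_ge0 ?exprn_ge0 ?(ltW l0) ?(ltW N0) //.
  have -> : (p * Rr) ^+ 2 * p ^+ 2 * (2 * Rr * l) ^+ 2 = 4 * (p * Rr) ^+ 4 * l ^+ 2 by ring.
  have -> : 2 ^+ 10 * l ^+ 6 = 4 * (4 * l) ^+ 4 * l ^+ 2 by ring.
  rewrite ler_wpM2r ?exprn_ge0 ?(ltW l0) // ler_wpM2l // lerXn2r ?nnegrE ?pr_le //.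
    by rewrite mulr_ge0 ?(ltW p0).
  by rewrite mulr_ge0 ?(ltW l0).
set Y := (Rr ^+ 2 * p * (q ^+ k) ^+ 2) in Y2 *.
have Y0 : 0 <= Y by rewrite !mulr_ge0 ?exprn_ge0 ?(ltW p0).
rewrite ler_pdivlMr ?exprn_gt0 // -(ler_pM2r (exprn_gt0 7 l0)) mul1r -[leLHS]mulrA -exprD.
apply: le_trans (ler_wpM2l Y0 pN) _; apply: le_trans Y2 _.
rewrite [l ^+ 7]exprS ler_wpM2r ?exprn_ge0 ?(ltW l0) //; by move: l_big; lra.
Qed.

(** From [k] to [r] the mean grows at least by the factor [(n - k) / r], since larger sets dominate
    with larger probability. This factor is at least [l ^+ 2]. *)
Lemma mean_r_ge : l <= dom_mean n p r.
Proof.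
have xk0 : 0 <= q ^+ k by rewrite exprn_ge0.
have xr0 : 0 <= q ^+ r by rewrite exprn_ge0.
have h : dom_mean n p k * ((n - k)%:R / Rr) <= dom_mean n p r.
  rewrite /dom_mean.
  have E : 'C(n, r)%:R * Rr = 'C(n, k)%:R * (n - k)%:R :> R.
    by rewrite -!natrM mulnC mul_bin_left mulnC.
  have -> : 'C(n, k)%:R * (1 - q ^+ k) ^+ (n - k) * ((n - k)%:R / Rr)
    = 'C(n, r)%:R * (1 - q ^+ k) ^+ (n - k).
    rewrite (_ : 'C(n, r)%:R = 'C(n, k)%:R * (n - k)%:R / Rr); first by ring.
    by rewrite -E mulfK ?pnatr_eq0.
  rewrite ler_wpM2l //; apply: (@le_trans _ _ ((1 - q ^+ k) ^+ (n - r))).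
    apply: ler_wiXn2l; [by move: xk_le8; lra|by lra|by rewrite subnS leq_pred].
  by apply: lerXn2r; rewrite ?nnegrE; move: xr_le_xk xk_le8; lra.
apply: le_trans h; rewrite (natrB _ (ltnW k_ltn)).
have r0 : 0 < Rr by rewrite ltr0n.
have nk : N / 2 <= N - k%:R by move: r_le; rewrite succ_natr; have := k_ge1; lra.
apply: (@le_trans _ _ (1 / l * (l ^+ 2))); first by rewrite expr2 div1r mulKf ?gt_eqF.
apply: ler_pM => //; first by rewrite divr_ge0 ?(ltW l0).
  by rewrite exprn_ge0 ?(ltW l0).
rewrite ler_pdivlMr //; apply: le_trans nk.
rewrite -(ler_pM2l p0).
have h3 : l ^+ 2 * (p * Rr) <= 4 * l ^+ 3.
  rewrite (_ : 4 * l ^+ 3 = l ^+ 2 * (4 * l)); last by ring.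
  by rewrite ler_wpM2l ?pr_le // exprn_ge0 ?(ltW l0).
have h4 : 8 * l ^+ 3 <= l ^+ 4.
  by rewrite [l ^+ 4]exprS ler_wpM2r ?exprn_ge0 ?(ltW l0) //; move: l64; lra.
have h5 : l ^+ 4 <= p * N.
  by apply: le_trans P7; do 2 (apply: le_trans (log_expS_ge _) _); exact: log_expS_ge.
lra.
Qed.

(** * Ratio bounds for one pair of [r]-sets *)

Section Pair.
Variables (K L : {set 'I_n}).
Hypotheses (cK : #|K| = r) (cL : #|L| = r).
Local Notation s := #|K :&: L|.
Local Notation a := (r - s)%N.
Local Notation J := (expect p (vertex_pairs n)
  (fun E => (dominating E K)%:R * (dominating E L)%:R)).
Local Notation P := ((1 - q ^+ r) ^+ (n - r)).

(** The denominator [(1 - q ^+ r) ^+ 2] is at least 2/3, which costs the factor 3/2; the bipartite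
    part is absorbed in [1 / l]. *)
Lemma pair_ratio_le (G : R) : 3 / 2 * (N * (q ^+ (r + a) * (1 - q ^+ s))) <= G ->
  J <= P ^+ 2 * expR (G + 1 / l).
Proof.
move=> HG; have := expect_pair_ratio (ltW p0) p_le1 (ltn0Sn k) xr_lt1 cK cL.
move/le_trans; apply; rewrite ler_wpM2l ?exprn_ge0 ?subr_ge0 ?(ltW xr_lt1) // ler_expR.
set D := (1 - q ^+ r) ^+ 2.
have D1 : 2 / 3 <= D.
  have : q ^+ r <= 1 / 8 by apply: le_trans xr_le_xk xk_le8.
  by rewrite /D expr2; move: (q ^+ r) => x hx; nra.
have D0 : 0 < D by lra.
rewrite ler_pdivrMr //.
have B := bipartite_le; set Y := _ * q ^+ (2 * r).-1 in B *.
set Z := N * _ in HG *.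
have Z0 : 0 <= Z.
  by rewrite mulr_ge0 // mulr_ge0 ?exprn_ge0 // subr_ge0 exprn_ile1.
have l1 : 3 / 2 * (1 / l ^+ 2) <= 1 / l.
  rewrite expr2 -(ler_pM2r (mulr_gt0 l0 l0)).
  have -> : 3 / 2 * (1 / (l * l)) * (l * l) = 3 / 2 by field; rewrite gt_eqF.
  have -> : 1 / l * (l * l) = l by field; rewrite gt_eqF.
  by move: l64; lra.
have il : 0 <= 1 / l by rewrite divr_ge0 ?(ltW l0).
have G0 : 0 <= G + 1 / l by lra.
apply: le_trans (_ : (G + 1 / l) * (2 / 3) <= _); last by rewrite ler_wpM2l.
lra.
Qed.


(** Brings an exponential in the overlap into the form summed by [sum_pow_setI]. *)
Lemma expR_pow_overlap (c : R) : (1 + (expR c - 1)) ^+ s = expR (c * s%:R).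
Proof. by rewrite addrC subrK -expRM_natl mulrC. Qed.

Lemma pair_exponent_le :
  N * (q ^+ (r + a) * (1 - q ^+ s)) <= 2 * k%:R * l * q ^+ a.+1.
Proof.
have qs : 1 - q ^+ s <= 1 by rewrite lerBlDr lerDl exprn_ge0.
have qra0 : 0 <= q ^+ (r + a) by rewrite exprn_ge0.
apply: (@le_trans _ _ (q ^+ k * N * q ^+ a.+1)).
  rewrite [q ^+ k * N]mulrC -[leRHS]mulrA ler_wpM2l ?(ltW N0) // -exprD addnS -addSn.
  by rewrite -[leRHS]mulr1 ler_wpM2l.
by rewrite ler_wpM2r ?exprn_ge0 // xk_le.
Qed.

(** For [s > 0] one has [k <= s * a.+1], and [a.+1 * q ^+ a.+1 <= q <= 1 / 4], so
    [k * q ^+ a.+1 <= s / 4]. *)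
Lemma pair_large_p : 3 / 4 <= p ->
  J <= P ^+ 2 * (expR (1 / l) * (1 + (expR (3 / 4 * l) - 1)) ^+ s).
Proof.
move=> p34; rewrite expR_pow_overlap -expRD [1 / l + _]addrC; apply: pair_ratio_le.
have [s0|s0] := posnP s; first by rewrite s0 expr0 subrr !mulr0.
have h3 : k%:R <= s%:R * a.+1%:R :> R.
  rewrite -natrM ler_nat; apply: leq_overlap_mul => //; exact: subnKC (card_overlap_le L cK).
have q4 : q <= 1 / 4 by move: p34; lra.
have h4 : a.+1%:R * q ^+ a.+1 <= 1 / 4.
  apply: le_trans (q4); apply: succ_mul_pow_le; rewrite q0 /=; lra.
have h5 : k%:R * q ^+ a.+1 <= s%:R * (1 / 4).
  apply: le_trans (ler_wpM2r (exprn_ge0 _ q0) h3) _.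
  by rewrite -mulrA ler_wpM2l.
have h6 := ler_wpM2r (ltW l0) h5.
have := pair_exponent_le; lra.
Qed.

(** Here [1 - q ^+ s <= p * s], while [q ^+ s >= 1 / 256] gives
    [q ^+ (r + a) <= 256 * (q ^+ k) ^+ 2]. The exponent is then a small multiple of [s] by
    [xk_pN_le]. *)
Lemma pair_small_overlap : p <= 3 / 4 -> p * s%:R <= 1 ->
  J <= P ^+ 2 * (expR (1 / l) * (1 + (expR (2 ^+ 15 * l ^+ 4 / (p * N)) - 1)) ^+ s).
Proof.
move=> p34 ps1; rewrite expR_pow_overlap -expRD [1 / l + _]addrC; apply: pair_ratio_le.
have p01 : 0 <= p <= 1 by rewrite p_le1 ltW.
have qs : 1 - q ^+ s <= p * s%:R.
  by have := bernoulli_ineq s p01; rewrite mulrC; lra.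
have qs0 : 0 <= 1 - q ^+ s by rewrite subr_ge0 exprn_ile1.
have qs4 : 1 / 256 <= q ^+ s.
  apply: (@le_trans _ _ (expR (- (4 * p * s%:R)))); last first.
    by apply: pow_compl_ge; rewrite p34 ltW.
  apply: (@le_trans _ _ (expR (- 4))); last by rewrite ler_expR -mulrA; lra.
  rewrite expRN -[leLHS]invrK lef_pV2 ?posrE ?expR_gt0 ?invr_gt0 ?divr_gt0 //; try lra.
  have -> : (1 / 256)^-1 = 4 ^+ 4 :> R by rewrite div1r invrK; ring.
  rewrite -[X in expR X](mulr1 4%:R) expRM_natl lerXn2r ?nnegrE ?expR_ge0 //.
  exact: expR1_le4.
have yy : q ^+ (r + a) <= 256 * (q ^+ k) ^+ 2.
  apply: (@le_trans _ _ (256 * (q ^+ (r + a) * q ^+ s))).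
    have := ler_wpM2l (exprn_ge0 (r + a) q0) qs4; lra.
  rewrite ler_wpM2l // -exprD -addnA subnK ?(card_overlap_le L cK) // exprD -expr2.
  by rewrite lerXn2r ?nnegrE ?exprn_ge0 // xr_le_xk.
have pN0 : 0 < p * N by rewrite mulr_gt0.
pose V := l ^+ 4 / (p * N).
have yp : (q ^+ k) ^+ 2 * (p * N) <= 64 * V.
  rewrite /V mulrA ler_pdivlMr //.
  have -> : 64 * l ^+ 4 = (8 * l ^+ 2) ^+ 2 by ring.
  have -> : q ^+ k ^+ 2 * (p * N) * (p * N) = (q ^+ k * (p * N)) ^+ 2 by ring.
  have y0 : 0 <= q ^+ k * (p * N) by rewrite mulr_ge0 ?exprn_ge0 ?(ltW pN0).
  by rewrite lerXn2r ?nnegrE ?xk_pN_le // (le_trans y0 xk_pN_le).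
have h1 : q ^+ (r + a) * (1 - q ^+ s) <= 256 * (q ^+ k) ^+ 2 * (p * s%:R).
  by apply: ler_pM; rewrite ?exprn_ge0.
have h2 : N * (q ^+ (r + a) * (1 - q ^+ s)) <= 256 * s%:R * ((q ^+ k) ^+ 2 * (p * N)).
  apply: le_trans (ler_wpM2l (ltW N0) h1) _.
  by rewrite le_eqVlt; apply/orP; left; apply/eqP; ring.
have h3 := ler_wpM2l (ler0n R s) yp.
have W0 : 0 <= s%:R * V.
  by rewrite mulr_ge0 // divr_ge0 ?exprn_ge0 ?(ltW pN0) ?(ltW l0).
rewrite -[2 ^+ 15 * _ / _]mulrA -/V.
move: h2 h3 W0; rewrite -[256 * _ * _]mulrA [s%:R * (64 * V)]mulrCA.
have -> : 2 ^+ 15 * V * s%:R = 128 * 256 * (s%:R * V) by ring.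
by move: (N * _) (s%:R * V) (s%:R * _) => A B C h2 h3 W0; lra.
Qed.

(** The exponent is at most [l * s / 8]. As [s >= 1 / p], this is at most [l * s / 4 - l / (8 * p)];
    the negative term later makes the sum over this region negligible. *)
Lemma pair_mid_overlap : 1 <= p * s%:R -> 6 <= p * a%:R ->
  J <= P ^+ 2 * (expR (1 / l - l / (8 * p)) * (1 + (expR (1 / 4 * l) - 1)) ^+ s).
Proof.
move=> ps pa; rewrite expR_pow_overlap -expRD.
have sp : 1 / p <= s%:R by rewrite ler_pdivrMr // mulrC.
(* If [r <= 2 * s], then [q ^+ a <= expR (- 6) <= 1 / 64] suffices. Otherwise [2 * a >= k], so
   [q ^+ a] is at most the square root of the tiny [q ^+ k], and
   [24 * p * r * q ^+ a <= 1 <= p * s]. *)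
have h24 : 24 * Rr * q ^+ a <= s%:R.
  have qa0 : 0 <= q ^+ a by rewrite exprn_ge0.
  have [rs|rs] := leqP r (2 * s).
    have qa : q ^+ a <= 1 / 64.
      apply: le_trans (q_pow_le p_le1 a) _.
      apply: (@le_trans _ _ (expR (- 6))); first by rewrite ler_expR lerN2.
      rewrite expRN -[leRHS]invrK lef_pV2 ?posrE ?expR_gt0 ?invr_gt0 ?divr_gt0 //; try lra.
      have -> : (1 / 64)^-1 = 2 ^+ 6 :> R by rewrite div1r invrK; ring.
      rewrite -[X in expR X](mulr1 6%:R) expRM_natl lerXn2r ?nnegrE ?expR_ge0 //.
      exact: expR1_ge2.
    have rs' : Rr <= 2 * s%:R by rewrite -natrM ler_nat.
    have h := ler_wpM2l (ler0n R r) qa.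
    have s0 : 0 <= s%:R :> R by [].
    by move: (q ^+ a) h rs' s0 => A h rs' s0; lra.
  have qa2 : (q ^+ a) ^+ 2 <= q ^+ k.
    rewrite -exprM; apply: ler_wiXn2l => //.
    by rewrite mulnBl muln2 mulnC; apply: leq_double_sub.
  have y5 : q ^+ k * l ^+ 5 <= 8.
    rewrite -(ler_pM2r (exprn_gt0 2 l0)) -[leLHS]mulrA -exprD.
    by apply: le_trans xk_pN_le; rewrite ler_wpM2l ?exprn_ge0.
  have sq : (24 * (p * Rr) * q ^+ a) ^+ 2 <= 1.
    rewrite exprMn; apply: (@le_trans _ _ ((24 * (4 * l)) ^+ 2 * q ^+ k)).
      have u0 : 0 <= 24 * (p * Rr) by rewrite !mulr_ge0 ?(ltW p0).
      have u1 : 24 * (p * Rr) <= 24 * (4 * l) by rewrite ler_wpM2l ?pr_le.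
      apply: ler_pM => //; [exact: exprn_ge0|exact: exprn_ge0|].
      by rewrite lerXn2r ?nnegrE // (le_trans u0).
    have l3 : (24 * 4) ^+ 2 * 8 <= l ^+ 3.
      have l2 : 64 * l <= l ^+ 2 by rewrite expr2 ler_wpM2r // ltW.
      have : 64 * l ^+ 2 <= l ^+ 3 by rewrite [l ^+ 3]exprS ler_wpM2r ?exprn_ge0 ?(ltW l0).
      by move: l_big l2; lra.
    rewrite -(ler_pM2r (exprn_gt0 3 l0)) mul1r; apply: le_trans l3.
    rewrite (_ : _ * l ^+ 3 = (24 * 4) ^+ 2 * (q ^+ k * l ^+ 5)); last by ring.
    by rewrite ler_wpM2l ?exprn_ge0.
  have z0 : 0 <= 24 * (p * Rr) * q ^+ a by rewrite !mulr_ge0 ?(ltW p0).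
  have z1 : 24 * (p * Rr) * q ^+ a <= 1.
    by rewrite -(@ler_pXn2r _ 2) ?nnegrE // expr1n.
  rewrite -(ler_pM2l p0); apply: le_trans ps.
  by apply: le_trans z1; rewrite le_eqVlt; apply/orP; left; apply/eqP; ring.
apply: le_trans (pair_ratio_le (G := 1 / 8 * l * s%:R) _) _.
  have h1 := pair_exponent_le.
  have h2 : 2 * k%:R * l * q ^+ a.+1 <= 2 * Rr * l * q ^+ a.
    apply: ler_pM; rewrite ?exprn_ge0 ?mulr_ge0 ?(ltW l0) //.
      by rewrite ler_wpM2r ?(ltW l0) // ler_wpM2l // ler_nat.
    by rewrite exprS ler_piMl ?exprn_ge0.
  have h3 := ler_wpM2l (ltW l0) h24.
  by move: h1 h2 h3; lra.
rewrite ler_wpM2l ?exprn_ge0 ?subr_ge0 ?(ltW xr_lt1) // ler_expR.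
have := ler_wpM2l (ltW l0) sp.
have -> : l / (8 * p) = 1 / 8 * (l * (1 / p)) by field; rewrite gt_eqF.
lra.
Qed.

(** * Lower bounds for [p <= 3 / 4], and nearly equal sets *)

Hypotheses (mean_pred : dom_mean n p k.-1 < 1 / l) (p_le34 : p <= 3 / 4).

Lemma pk_ge : l / 16 <= p * k%:R.
Proof.
have p01 : 0 <= p <= 3 / 4 by rewrite p_le34 ltW.
by have := le_trans (pow_compl_ge k p01) xk_le_exp; rewrite ler_expR; lra.
Qed.

Lemma k_ge4 : 4 <= k%:R :> R.
Proof.
have := pk_ge; have := ler_wpM2r (ler0n R k) p_le1; move: l64; lra.
Qed.

(** With [j = k.-1], the binomial is at least [(n / j) ^ j], and [n / j] exceeds the fourth root of
    [n]. *)
Lemma bin_pred_ge : expR (k.-1%:R * (1 / 4 * l)) <= 'C(n, k.-1)%:R.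
Proof.
have k4 : (4 <= k)%N by rewrite -(ler_nat R) k_ge4.
have j0 : (0 < k.-1)%N by case: k k4 => [|[]].
have jn : (k.-1 <= n)%N by apply: leq_trans (leq_pred _) (ltnW k_ltn).
have j00 : 0 < k.-1%:R :> R by rewrite ltr0n.
have := bin_sub_le (leqnn k.-1) jn; rewrite subnn bin0 mul1n -(ler_nat R) natrM !natrX => H.
rewrite expRM_natl -(ler_pM2r (exprn_gt0 k.-1 j00)); apply: le_trans H.
rewrite -exprMn lerXn2r ?nnegrE ?mulr_ge0 ?expR_ge0 //.
rewrite -(ler_pM2l p0); apply: le_trans (pN_ge nE p_big).
have jr : p * k.-1%:R <= 4 * l.
  apply: le_trans pr_le; rewrite ler_wpM2l ?(ltW p0) // ler_nat.
  by rewrite (leq_trans (leq_pred _)).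
rewrite mulrCA mulrC; apply: ler_pM; rewrite ?mulr_ge0 ?expR_ge0 ?(ltW p0) //.
  apply: le_trans jr _; apply: (@le_trans _ _ (l * l)); last first.
    by rewrite -expr2 log_expS_ge.
  by rewrite ler_wpM2r ?(ltW l0) //; move: l64; lra.
by rewrite ler_expR ler_wpM2r ?(ltW l0) //; lra.
Qed.

(** With [j = k.-1] and [y = q ^+ j], the small mean at [j] and [bin_pred_ge] force
    [j * l <= 8 * N * y]. Passing from [j] to [r] costs two factors [q >= 1 / 4], and
    [r <= 2 * j]. *)
Lemma xr_ge : Rr * l / 256 <= q ^+ r * N.
Proof.
have k4 := k_ge4.
have kE : k = k.-1.+1 by rewrite prednK.
have kR : k%:R = k.-1%:R + 1 :> R by rewrite natr1 -kE.
have q4 : 1 / 4 <= q by move: p_le34; lra.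
set j := k.-1; set y := q ^+ j.
have y0 : 0 <= y by rewrite exprn_ge0.
have yk : q ^+ k = q * y by rewrite {1}kE exprS.
have y1 : y <= 1 / 2.
  have := xk_le8; rewrite yk; have := ler_wpM2r y0 q4; lra.
have m1 : (1 - y) ^+ (n - j) * expR (j%:R * (1 / 4 * l)) <= 1.
  rewrite mulrC; apply: (@le_trans _ _ (dom_mean n p j)).
    rewrite /dom_mean ler_wpM2r ?bin_pred_ge // exprn_ge0 //.
    by move: y1; rewrite -/y; lra.
  apply: (le_trans (ltW mean_pred)).
  by rewrite ler_pdivrMr // mul1r; move: l64; lra.
have y01 : 0 <= y <= 1 / 2 by rewrite y0.
have m2 := ler_wpM2r (expR_ge0 (j%:R * (1 / 4 * l))) (pow_one_sub_ge (n - j) y01).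
have := le_trans m2 m1; rewrite -expRD -[leRHS]expR0 ler_expR => H.
have nj : (n - j)%:R * y <= N * y by rewrite ler_wpM2r // ler_nat leq_subr.
have h1 : j%:R * l <= 8 * (N * y) by lra.
have h2 : 1 / 16 * y <= q ^+ r.
  rewrite exprS yk mulrA ler_wpM2r //.
  have := ler_pM _ _ q4 q4; rewrite (_ : 0 <= 1 / 4); last by lra.
  by move=> /(_ isT isT); lra.
have h3 := ler_wpM2r (ltW N0) h2.
have h4 : Rr * l <= 2 * (j%:R * l).
  by rewrite mulrA ler_wpM2r ?(ltW l0) // succ_natr; move: k4; rewrite kR -/j; lra.
by lra.
Qed.

Lemma pair_near : p * a%:R <= 6 -> J <= P * ((1 / N) ^+ 2) ^+ a.
Proof.
move=> pa6; apply: le_trans (expect_pair_near (ltW p0) p_le1 xr_lt1 cK cL) _.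
rewrite ler_wpM2l ?exprn_ge0 ?subr_ge0 ?(ltW xr_lt1) //.
have -> : ((1 / N) ^+ 2) ^+ a = expR (- (a%:R * (2 * l))).
  by rewrite -mulrN expRM_natl expRN expRM_natl nE div1r exprVn.
rewrite ler_expR lerN2.
have pa0 : 0 <= p * a%:R by rewrite mulr_ge0 ?(ltW p0).
have h1 : p * a%:R / 7 <= 1 - q ^+ a.
  apply: le_trans (_ : 1 - expR (- (p * a%:R)) <= _).
    by apply: one_sub_exp_ge; rewrite pa0.
  by rewrite lerD2l lerN2 q_pow_le.
have h2 : N / 2 <= (n - (r + a))%:R.
  rewrite natrB; last by apply: card_union_le cK cL.
  have ar : a%:R <= Rr by rewrite ler_nat leq_subr.
  by rewrite natrD; move: N0 r_le ar; lra.
have h3 : Rr * l / 256 * (p * a%:R / 7) <= q ^+ r * N * (1 - q ^+ a).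
  by apply: ler_pM xr_ge h1; rewrite divr_ge0 ?mulr_ge0 ?(ltW l0) ?(ltW p0).
have h4 : N / 2 * (q ^+ r * (1 - q ^+ a)) <= (n - (r + a))%:R * (q ^+ r * (1 - q ^+ a)).
  by rewrite ler_wpM2r // mulr_ge0 ?exprn_ge0 // subr_ge0 exprn_ile1.
have pr : l / 16 <= p * Rr.
  by apply: le_trans pk_ge _; rewrite ler_wpM2l ?(ltW p0) // ler_nat.
have la0 : 0 <= l * a%:R by rewrite mulr_ge0 ?(ltW l0).
have h5 := ler_wpM2l la0 pr.
(* The number is [2 * 16 * 2 * 256 * 7]: the wanted rate 2, then the losses in [pr], [h2], [xr_ge]
   and [h1]. *)
have h6 : 112 * 1024 <= l by move: l_big; lra.
have h7 := ler_wpM2l la0 h6.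
by move: h3 h4 h5 h7; lra.
Qed.

End Pair.

(** * Summation over the overlap regions *)

Hypotheses (mean_pred : dom_mean n p k.-1 < 1 / l).

Let n_gt0 : (0 < n)%N. Proof. by rewrite -(ltr0n R). Qed.
Let P_gt0 : 0 < (1 - q ^+ r) ^+ (n - r). Proof. by rewrite exprn_gt0 // subr_gt0 xr_lt1. Qed.
Let Ni_ge0 : 0 <= 1 / N. Proof. by rewrite divr_ge0. Qed.
Let p01 : 0 <= p <= 1. Proof. by rewrite p_le1 ltW. Qed.

Lemma expR_sub1_ge0 (c : R) : 0 <= c -> 0 <= expR c - 1.
Proof. by move=> c0; rewrite subr_ge0 -expR0 ler_expR. Qed.

Lemma expR_inv_log_mul (c : R) : c <= 1 / l -> expR (1 / l) * expR c <= expR (2 / l).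
Proof. by move=> cl; rewrite -expRD ler_expR; lra. Qed.

Lemma near_diagonal_le : expR (N * (1 / N)) / dom_mean n p r <= 4 / l.
Proof.
rewrite mulrCA mulfV ?gt_eqF // mulr1.
apply: ler_pM; rewrite ?expR_ge0 ?invr_ge0 ?expR1_le4 //.
  exact: le_trans (ltW l0) mean_r_ge.
by rewrite lef_pV2 ?posrE ?mean_r_ge // (lt_le_trans l0 mean_r_ge).
Qed.

(** One region suffices, hence [c2 = 0]. As [r <= 6 * l], the rate [expR (3 / 4 * l)] times
    [r ^+ 2 / N] is still at most [1 / l]. *)
Lemma second_moment_large_p : 3 / 4 <= p ->
  expect p (vertex_pairs n) (fun E => dom_count R r E ^+ 2)
  <= (expR (2 / l) + 5 / l) * dom_mean n p r ^+ 2.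
Proof.
move=> p34.
apply: le_trans (second_moment_regions (c1 := expR (1 / l)) (c2 := 0)
  (t1 := expR (3 / 4 * l) - 1) (t2 := 0) (t := 1 / N)
  p01 n_gt0 k_ltn _ _ _ _ _ P_gt0 _) _ => //.
- by apply: expR_sub1_ge0; rewrite mulr_ge0 ?(ltW l0) //; lra.
- by move=> K L cK cL; constructor 1; apply: pair_large_p.
rewrite ler_wpM2r ?sqr_ge0 // mul0r addr0; apply: lerD; last first.
  apply: le_trans near_diagonal_le _; rewrite ler_wpM2r ?invr_ge0 ?(ltW l0) //; lra.
apply: expR_inv_log_mul; rewrite ler_pdivrMr // [leRHS]mulrAC [1 * N]mul1r ler_pdivlMr //.
have r6 : Rr <= 6 * l.
  have := pr_le; have := ler_wpM2r (ler0n R r) p34; move: l64; lra.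
have r2 : Rr ^+ 2 * l <= l ^+ 4.
  apply: (@le_trans _ _ ((6 * l) ^+ 2 * l)).
    by rewrite ler_wpM2r ?(ltW l0) // lerXn2r ?nnegrE // mulr_ge0 ?(ltW l0).
  rewrite (_ : l ^+ 4 = l * (l ^+ 2 * l)); last by ring.
  rewrite exprMn -[leLHS]mulrA ler_wpM2r ?mulr_ge0 ?exprn_ge0 ?(ltW l0) //.
  by move: l64; lra.
rewrite -[leLHS]mulrA.
apply: (@le_trans _ _ (expR (3 / 4 * l) * expR (1 / 4 * l))); last first.
  by rewrite -expRD nE ler_expR; lra.
apply: ler_pM; rewrite ?mulr_ge0 ?exprn_ge0 ?(ltW l0) //.
- by apply: expR_sub1_ge0; rewrite mulr_ge0 ?(ltW l0) //; lra.
- by rewrite lerBlDr lerDl.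
- by apply: le_trans r2 _; apply: (log4_le_exp l_big l_exp); lra.
Qed.

Let pN0 : 0 < p * N. Proof. by rewrite mulr_gt0. Qed.
Let d := 2 ^+ 15 * l ^+ 4 / (p * N).

Lemma small_overlap_rate : 0 <= d <= 1 / 2.
Proof.
apply/andP; split.
  by apply: divr_ge0 (ltW pN0); apply: mulr_ge0; rewrite exprn_ge0 ?(ltW l0).
rewrite ler_pdivrMr //.
have : 2 ^+ 16 * l ^+ 4 <= l ^+ 7.
  rewrite (_ : l ^+ 7 = l ^+ 3 * l ^+ 4); last by ring.
  rewrite ler_wpM2r ?exprn_ge0 ?(ltW l0) //.
  apply: (@le_trans _ _ l); first by move: l_big; lra.
  by rewrite -[leLHS]expr1; apply: le_trans (log_expS_ge _) _; exact: log_expS_ge.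
by move=> H; have := le_trans H P7; lra.
Qed.

(** Up to the factor 2, the exponent is [d * r ^+ 2 / N = 2 ^+ 15 * l ^+ 4 * (p * r) ^+ 2 / (p ^+ 3
    * N ^+ 2)], so [p3N2_ge] makes it of order [1 / l ^+ 3]. *)
Lemma small_overlap_sum_le :
  expR (1 / l) * expR ((expR d - 1) * Rr ^+ 2 / N) <= expR (2 / l).
Proof.
have /andP[d0 d2] := small_overlap_rate.
apply: expR_inv_log_mul.
have W0 : 0 <= d * Rr ^+ 2 / N by rewrite divr_ge0 // mulr_ge0 ?exprn_ge0.
apply: (@le_trans _ _ (2 * (d * Rr ^+ 2 / N))).
  move: d d0 d2 => e e0 e2.
  rewrite (_ : 2 * _ = 2 * e * Rr ^+ 2 / N); last by ring.
  rewrite ler_wpM2r ?invr_ge0 // ler_wpM2r ?exprn_ge0 //.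
  by apply: expRB1_le; rewrite e0.
have W1 : d * Rr ^+ 2 / N * (p ^+ 3 * N ^+ 2) = 2 ^+ 15 * l ^+ 4 * (p * Rr) ^+ 2.
  rewrite /d; move: (2 ^+ 15) => c; field.
  by rewrite !gt_eqF.
have W2 : d * Rr ^+ 2 / N * l ^+ 9 <= 2 ^+ 15 * l ^+ 4 * (4 * l) ^+ 2.
  apply: le_trans (ler_wpM2l W0 (p3N2_ge nE l_big p_big)) _; rewrite W1.
  apply: ler_wpM2l; first by apply: mulr_ge0; rewrite exprn_ge0 ?(ltW l0).
  by rewrite lerXn2r ?nnegrE ?pr_le ?mulr_ge0 ?(ltW p0) ?(ltW l0).
rewrite ler_pdivlMr // -(ler_pM2r (exprn_gt0 8 l0)) mul1r.
have -> : 2 * (d * Rr ^+ 2 / N) * l * l ^+ 8 = 2 * (d * Rr ^+ 2 / N * l ^+ 9).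
  by move: d => e; ring.
apply: le_trans (ler_wpM2l _ W2) _; first by lra.
rewrite (_ : l ^+ 8 = l * l * l ^+ 6); last by ring.
rewrite (_ : 2 * _ = 2 ^+ 10 * 2 ^+ 10 * l ^+ 6); last by ring.
rewrite ler_wpM2r ?exprn_ge0 ?(ltW l0) //.
by apply: ler_pM; rewrite ?exprn_ge0 //; move: l_big; lra.
Qed.

(** Summation costs at most [l / (16 * p)] in the exponent, half of the available [l / (8 * p)]; the
    remainder is at most [1 - l / 16]. *)
Lemma mid_overlap_sum_le :
  expR (1 / l - l / (8 * p)) * expR ((expR (1 / 4 * l) - 1) * Rr ^+ 2 / N) <= 1 / l.
Proof.
rewrite -expRD; apply: (@le_trans _ _ (expR (1 - l / 16))).
  rewrite ler_expR.
  have T2 : (expR (1 / 4 * l) - 1) * Rr ^+ 2 / N <= l / (16 * p).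
    rewrite ler_pdivrMr // [leRHS]mulrAC ler_pdivlMr ?mulr_gt0 //.
    rewrite -(ler_pM2r p0).
    apply: (@le_trans _ _ (16 * expR (1 / 4 * l) * (p * Rr) ^+ 2)).
      rewrite (_ : (expR (1 / 4 * l) - 1) * Rr ^+ 2 * (16 * p) * p
        = 16 * (expR (1 / 4 * l) - 1) * (p * Rr) ^+ 2); last by ring.
      rewrite ler_wpM2r ?exprn_ge0 ?mulr_ge0 ?(ltW p0) // ler_wpM2l //.
      by rewrite lerBlDr lerDl.
    apply: (@le_trans _ _ (16 * expR (1 / 4 * l) * (4 * l) ^+ 2)).
      rewrite ler_wpM2l ?mulr_ge0 ?expR_ge0 //.
      by rewrite lerXn2r ?nnegrE ?pr_le ?mulr_ge0 ?(ltW p0) ?(ltW l0).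
    rewrite -[leRHS]mulrA [N * p]mulrC; apply: le_trans (ler_wpM2l (ltW l0) (pN_ge nE p_big)).
    rewrite [leRHS]mulrA.
    rewrite (_ : 16 * _ * _ = (16 * 16 * l ^+ 2) * expR (1 / 4 * l)); last by ring.
    apply: ler_pM; rewrite ?expR_ge0 //.
    - by apply: mulr_ge0; rewrite ?exprn_ge0 ?(ltW l0).
    - rewrite (_ : l * l ^+ 3 = l ^+ 2 * l ^+ 2); last by ring.
      rewrite ler_wpM2r ?exprn_ge0 ?(ltW l0) //.
      have l2 : 64 * l <= l ^+ 2 by rewrite expr2 ler_wpM2r // ltW.
      by move: l64; lra.
    - by rewrite ler_expR ler_wpM2r ?(ltW l0) //; lra.
  have l1 : 1 / l <= 1 by rewrite ler_pdivrMr // mul1r; move: l64; lra.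
  have ip : 1 <= p^-1 by rewrite invf_ge1.
  have lp := ler_wpM2l (ltW l0) ip.
  have e8 : l / (8 * p) = l * p^-1 / 8 by field; rewrite gt_eqF.
  have e16 : l / (16 * p) = l * p^-1 / 16 by field; rewrite gt_eqF.
  by rewrite e8; move: T2; rewrite e16; lra.
rewrite expRD expRN ler_pdivrMr ?expR_gt0 //.
rewrite [1 / l * _]mulrC mulrA mulr1 ler_pdivlMr //; apply: le_trans l_exp.
apply: (@le_trans _ _ (4 * l)); first by rewrite ler_wpM2r ?(ltW l0) // expR1_le4.
apply: (@le_trans _ _ (l ^+ 2)).
  by rewrite expr2 ler_wpM2r ?(ltW l0) //; move: l64; lra.
by apply: le_trans (log_expS_ge _) _; exact: log_expS_ge.
Qed.

Lemma second_moment_le :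
  expect p (vertex_pairs n) (fun E => dom_count R r E ^+ 2)
  <= (expR (2 / l) + 5 / l) * dom_mean n p r ^+ 2.
Proof.
have [p34|p34] := leP (3 / 4) p; first exact: second_moment_large_p.
have /andP[d0 d2] := small_overlap_rate.
apply: le_trans (second_moment_regions (c1 := expR (1 / l)) (c2 := expR (1 / l - l / (8 * p)))
  (t1 := expR d - 1) (t2 := expR (1 / 4 * l) - 1) (t := 1 / N)
  p01 n_gt0 k_ltn _ _ _ _ _ P_gt0 _) _ => //.
- exact: expR_sub1_ge0.
- by apply: expR_sub1_ge0; rewrite mulr_ge0 ?(ltW l0) //; lra.
- move=> K L cK cL.
  have [ps|ps] := leP (p * #|K :&: L|%:R) 1.
    by constructor 1; apply: pair_small_overlap (ltW p34) ps.
  have [pa|pa] := leP (p * (r - #|K :&: L|)%:R) 6.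
    by constructor 3; apply: pair_near (ltW p34) pa.
  by constructor 2; apply: pair_mid_overlap (ltW ps) (ltW pa).
rewrite ler_wpM2r ?sqr_ge0 // -addrA.
have -> : 5 / l = 1 / l + 4 / l by ring.
exact: lerD small_overlap_sum_le (lerD mid_overlap_sum_le near_diagonal_le).
Qed.

End Estimates.

(** * Assembly and the limit *)

Lemma two_point_concentration (R : realType) (n : nat) (p l : R) :
  p <= 1 -> n%:R = expR l -> 10 ^+ 9 <= l -> l ^+ 3 * expR (- (2 / 3 * l)) <= p ->
  exists k : nat, 1 - 10 / l <= Gnp_prob p (fun E : {set {set 'I_n}} =>
    ((domination_number E)%:Z == k%:Z) || ((domination_number E)%:Z == k%:Z + 1)).
Proof.
move=> p_le1 nE l9 p_big.
have l_big : 10 ^+ 6 <= l by lra.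
have l0 := log_gt0 l_big.
have l_exp : l ^+ 4 <= expR (l / 16).
  (* The degree five term of the exponential series gives the bound once [l >= 120 * 16 ^+ 5], hence
     the constant [10 ^+ 9]. *)
  have l16 : 0 <= l / 16 by lra.
  have := expR_ge1Dxn 4 l16; apply: le_trans.
  have -> : (5`!%N)%:R = 120 :> R by [].
  have h : 120 * 16 ^+ 5 <= l by lra.
  have := ler_wpM2r (exprn_ge0 4 (ltW l0)) h.
  have -> : (l / 16) ^+ 5 / 120 = l ^+ 5 / (120 * 16 ^+ 5).
    by rewrite expr_div_n -mulrA -invfM [16 ^+ 5 * _]mulrC.
  rewrite -exprS mulrC -ler_pdivlMr ?mulr_gt0 ?exprn_gt0 // => H.
  by apply: le_trans H _; lra.
have p0 := p_gt0 l_big p_big.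
have [k [k0 kn mp mk pk]] := exists_threshold p_le1 nE l_big l_exp p_big.
exists k; have m0 := mean_r_ge p_le1 nE l_big l_exp p_big k0 kn mk pk.
have sm := second_moment_le p_le1 nE l_big l_exp p_big k0 kn mk pk mp.
have := two_point_prob (ltW p0) p_le1 k0 kn (lt_le_trans l0 m0) sm.
apply: le_trans.
have e1 : expR (2 / l) - 1 <= 2 * (2 / l).
  apply: expRB1_le; rewrite divr_ge0 ?(ltW l0) //= ler_pdivrMr //; lra.
(* The three losses are the mean at [k.-1], the second moment error [5 / l], and
   [expR (2 / l) - 1]. *)
have -> : 10 / l = 1 / l + 5 / l + 2 * (2 / l) by ring.
lra.
Qed.

Local Open Scope classical_set_scope.

Theorem theorem1 (R : realType) (p : nat -> R)
    (hp01 : forall n : nat, 0 <= p n <= 1)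
    (hp : \forall n \near \oo,
        ln (n%:R : R) ^+ 3 * (n%:R : R) `^ (- (2 / 3)) <= p n <= 1) :
  exists r : nat -> int,
    (fun n : nat =>
       Gnp_prob (p n) (fun E : {set {set 'I_n}} =>
         ((domination_number E)%:Z == r n)
         || ((domination_number E)%:Z == r n + 1)))
      @ \oo --> (1 : R).
Proof.
pose l n := ln (n%:R : R).
(* The largeness conditions are premises, so that [k] is defined for every [n]; where they fail its
   value is 0. *)
have /choice[k kP] : forall n, exists k : nat,
    10 ^+ 9 <= l n -> l n ^+ 3 * (n%:R : R) `^ (- (2 / 3)) <= p n ->
    1 - 10 / l n <= Gnp_prob (p n) (fun E : {set {set 'I_n}} =>
      ((domination_number E)%:Z == k%:Z) || ((domination_number E)%:Z == k%:Z + 1)).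
  move=> n; have [l9|l9] := leP (10 ^+ 9) (l n); last by exists 0%N.
  have [pb|pb] := leP (l n ^+ 3 * (n%:R : R) `^ (- (2 / 3))) (p n); last by exists 0%N.
  have n0 : 0 < (n%:R : R).
    rewrite lt_neqAle ler0n andbT; apply: contraTneq l9 => n0.
    by rewrite /l -n0 ln0 // -ltNge exprn_gt0.
  have /andP[_ p1] := hp01 n.
  have nE : n%:R = expR (l n) by rewrite lnK.
  have := two_point_concentration p1 nE l9.
  have -> : - (2 / 3 * l n) = - (2 / 3) * l n by rewrite mulNr.
  have -> : expR (- (2 / 3) * l n) = (n%:R : R) `^ (- (2 / 3)).
    by rewrite /powR gt_eqF.
  by move=> /(_ pb)[k kP]; exists k.
exists (fun n => (k n)%:Z).
apply/cvgrPdist_le => e e0; near=> n.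
(* Large [n] makes the estimate applicable and its error [10 / l n] at most [e]. *)
have h1 : Num.max (10 ^+ 9) (10 / e) <= l n.
  rewrite /l -[leLHS]expRK ler_ln ?posrE ?expR_gt0 //.
    by near: n; apply: nbhs_infty_ger.
  apply: lt_le_trans (expR_gt0 (Num.max (10 ^+ 9) (10 / e))) _.
  by near: n; apply: nbhs_infty_ger.
have /andP[l9 le] : (10 ^+ 9 <= l n) && (10 / e <= l n) by rewrite -ge_max.
have /andP[p0 p1] := hp01 n.
have pb : l n ^+ 3 * (n%:R : R) `^ (- (2 / 3)) <= p n.
  by have : ln (n%:R : R) ^+ 3 * (n%:R : R) `^ (- (2 / 3)) <= p n <= 1; [near: n|case/andP].
have H := kP n l9 pb.
rewrite ger0_norm ?subr_ge0 ?Gnp_prob_le1 //.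
have l0 : 0 < l n by apply: lt_le_trans l9; rewrite exprn_gt0.
have : 10 / l n <= e by rewrite ler_pdivrMr // mulrC -ler_pdivrMr.
by move: H; lra.
Unshelve. all: by end_near.
Qed.
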